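(* Let $\mathfrak{L}$ be the set of Lyndon words over the totally ordered alphabet $\mathrm{Comp}_{\mathrm{con}}$ of connected matrix compositions, and for $w=\mathbf{w}_1\cdots\mathbf{w}_n\in\mathfrak{L}$ let $\mathcal{B}_w:=\mathrm{diag}(\mathbf{w}_1,\dots,\mathbf{w}_n)\in H$. Then the family $(\mathcal{B}_w)_{w\in\mathfrak{L}}$ freely generates each of the three commutative $\mathbb{K}$-algebras $(H,\sqcup\!\sqcup_{\square},+)$, $(H,\sqcup\!\sqcup,+)$ and $(H,\sqcup\!\sqcup^{\mathsf{qs}},+)$ (block shuffle, two-parameter shuffle, and two-parameter quasi-shuffle algebra).
   Context: $\mathbb{K}$ is a commutative $\mathbb{Q}$-algebra, $d\ge 1$, and $(\mathfrak{M}_d,\star,\varepsilon)$ is the free commutative monoid generated by $d$ letters, with neutral element $\varepsilon$. A family freely generates a commutative $\mathbb{K}$-algebra if it is algebraically independent over $\mathbb{K}$ and generates the algebra, i.e. the canonical map from the polynomial $\mathbb{K}$-algebra on the index set is an isomorphism. A matrix composition is either the empty composition $\mathsf{e}$ (with $0$ rows and $0$ columns) or a matrix of size $m\times n$, $m,n\ge 1$, with entries in $\mathfrak{M}_d$ having no row and no column consisting only of $\varepsilon$. $\mathrm{Comp}$ is the set of matrix compositions and $H=\bigoplus_{\mathbf{a}\in\mathrm{Comp}}\mathbb{K}\mathbf{a}$. For $\mathbf{a},\mathbf{b}\in\mathrm{Comp}$, $\mathrm{diag}(\mathbf{a},\mathbf{b})$ is the block diagonal matrix with blocks $\mathbf{a},\mathbf{b}$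 and all off-diagonal-block entries equal to $\varepsilon$; $\mathsf{e}$ is neutral for $\mathrm{diag}$; $\mathrm{diag}$ is extended bilinearly to $H$. A nonempty $\mathbf{c}\in\mathrm{Comp}$ is connected if $\mathbf{c}=\mathrm{diag}(\mathbf{a},\mathbf{b})$ implies $\mathbf{a}=\mathsf{e}$ or $\mathbf{b}=\mathsf{e}$; $\mathrm{Comp}_{\mathrm{con}}$ is the set of connected compositions. Every nonempty composition is uniquely $\mathrm{diag}(\mathbf{u}_1,\dots,\mathbf{u}_\ell)$ with all $\mathbf{u}_i$ connected. Products on $H$ (all bilinear with neutral element $\mathsf{e}$): (1) Block shuffle $\sqcup\!\sqcup_{\square}$: $\mathrm{diag}(\mathbf{a},\mathbf{u})\sqcup\!\sqcup_{\square}\mathrm{diag}(\mathbf{b},\mathbf{v})=\mathrm{diag}(\mathbf{a},\mathbf{u}\sqcup\!\sqcup_{\square}\mathrm{diag}(\mathbf{b},\mathbf{v}))+\mathrm{diag}(\mathbf{b},\mathrm{diag}(\mathbf{a},\mathbf{u})\sqcup\!\sqcup_{\square}\mathbf{v})$ for connected $\mathbf{a},\mathbf{b}$ and $\mathbf{u},\mathbf{v}\in\mathrm{Comp}$. (2) Two-parameter shuffle $\sqcup\!\sqcup$: for nonempty $\mathbf{a}$ (size $m\times n$), $\mathbf{b}$ (size $s\times t$), $\mathbf{a}\sqcup\!\sqcup\mathbf{b}=\sum_{p\in\mathrm{sh}(m,s)}\sum_{q\in\mathrm{sh}(n,t)}(\mathrm{diag}(\mathbf{a},\mathbf{b})_{p^{-1}(u),q^{-1}(v)})_{u,v}$,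 where $\mathrm{sh}(m,s)$ is the set of permutations $q$ of $\{1,\dots,m+s\}$ with $q(1)<\dots<q(m)$ and $q(m+1)<\dots<q(m+s)$. (3) Two-parameter quasi-shuffle $\sqcup\!\sqcup^{\mathsf{qs}}$: for nonempty $\mathbf{a}$ (size $m\times n$), $\mathbf{b}$ (size $s\times t$), $\mathbf{a}\sqcup\!\sqcup^{\mathsf{qs}}\mathbf{b}=\sum_{j,k\ge1}\sum_{p\in\mathrm{qsh}(m,s;j)}\sum_{q\in\mathrm{qsh}(n,t;k)}\mathbf{c}^{p,q}$, where $\mathbf{c}^{p,q}$ is the $j\times k$ matrix with entries $\mathbf{c}^{p,q}_{x,y}=\bigstar_{u\in p^{-1}(x),\,v\in q^{-1}(y)}\mathrm{diag}(\mathbf{a},\mathbf{b})_{u,v}$, and $\mathrm{qsh}(m,s;j)$ is the set of surjections $q:\{1,\dots,m+s\}\to\{1,\dots,j\}$ with $q(1)<\dots<q(m)$ and $q(m+1)<\dots<q(m+s)$. Each of these makes $H$ a commutative associative unital $\mathbb{K}$-algebra. Fix a strict total order on $\mathrm{Comp}_{\mathrm{con}}$. On words over $\mathrm{Comp}_{\mathrm{con}}$, $<_{\mathrm{lex}}$ is the usual lexicographic order (a proper prefix is smaller). A Lyndon word is a nonempty word over $\mathrm{Comp}_{\mathrm{con}}$ that is strictly $<_{\mathrm{lex}}$-smaller than each of its proper nonempty suffixes. *)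

(* Defs.v *)
From HB Require Import structures.
From mathcomp Require Import all_boot all_order all_algebra all_fingroup finmap.
From mathcomp Require Import boolp monalg.

Set Implicit Arguments.
Unset Strict Implicit.
Unset Printing Implicit Defensive.

Import GRing.Theory.
Local Open Scope ring_scope.

(* The free commutative monoid on [d] letters is [{cmonom 'I_d}], with neutral
   element [mone] and product [mmul]. *)

Definition no_trivial_line d m n (A : 'M[{cmonom 'I_d}]_(m, n)) : bool :=
  [forall i, exists j, A i j != mone] && [forall j, exists i, A i j != mone].

(* Sizes [0 x n] and [n x 0] with [n > 0] are excluded by [mxP], as a line of
   length 0 is trivial; the [0 x 0] matrix is the empty composition. *)
Record mcomp d := MComp {
  nrows : nat;
  ncols : nat;
  mx : 'M[{cmonom 'I_d}]_(nrows, ncols);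
  mxP : no_trivial_line mx }.

Section CompChoice.
Variable d : nat.

Let family (mn : nat * nat) : choiceType := 'M[{cmonom 'I_d}]_(mn.1, mn.2).
Let raw := {A : {mn : nat * nat & family mn} |
  @no_trivial_line d (tag A).1 (tag A).2 (tagged A)}.

Let enc (c : mcomp d) : raw :=
  exist _ (Tagged family (i := (nrows c, ncols c)) (mx c)) (mxP c).
Let dec (A : raw) : mcomp d := MComp (proj2_sig A).

Lemma mcomp_encK : cancel enc dec.
Proof. by case. Qed.

HB.instance Definition _ := Choice.copy (mcomp d) (can_type mcomp_encK).
End CompChoice.

Section Comp.
Variable d : nat.
Local Notation M := {cmonom 'I_d}.
Implicit Types a b c u v : mcomp d.

Lemma no_trivial_lineP m n (A : 'M[M]_(m, n)) :
  reflect ((forall i, exists j, A i j != mone) /\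
           (forall j, exists i, A i j != mone)) (no_trivial_line A).
Proof.
apply: (iffP andP) => -[H1 H2]; split.
- by move=> i; apply/existsP; apply: (forallP H1).
- by move=> i; apply/existsP; apply: (forallP H2).
- by apply/forallP => i; apply/existsP.
- by apply/forallP => i; apply/existsP.
Qed.

Lemma empty_comp_subproof : no_trivial_line (const_mx mone : 'M[M]_(0, 0)).
Proof. by apply/no_trivial_lineP; split; case. Qed.

Definition empty_comp : mcomp d := MComp empty_comp_subproof.

Definition diag_block m n s t (A : 'M[M]_(m, n)) (B : 'M[M]_(s, t)) :
    'M[M]_(m + s, n + t) :=
  block_mx A (const_mx mone) (const_mx mone) B.

Lemma diag_block_subproof m n s t (A : 'M[M]_(m, n)) (B : 'M[M]_(s, t)) :
  no_trivial_line A -> no_trivial_line B -> no_trivial_line (diag_block A B).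
Proof.
move=> /no_trivial_lineP[rA cA] /no_trivial_lineP[rB cB].
apply/no_trivial_lineP; split=> i; case: (splitP i) => k Hk.
- have [j Hj] := rA k; exists (lshift t j).
  by rewrite (_ : i = lshift s k) ?block_mxEul //; apply: val_inj.
- have [j Hj] := rB k; exists (rshift n j).
  by rewrite (_ : i = rshift m k) ?block_mxEdr //; apply: val_inj.
- have [j Hj] := cA k; exists (lshift s j).
  by rewrite (_ : i = lshift t k) ?block_mxEul //; apply: val_inj.
- have [j Hj] := cB k; exists (rshift m j).
  by rewrite (_ : i = rshift n k) ?block_mxEdr //; apply: val_inj.
Qed.

Definition diag a b : mcomp d := MComp (diag_block_subproof (mxP a) (mxP b)).

Definition connected c : bool :=
  (c != empty_comp) &&
  `[< forall a b, c = diag a b -> a = empty_comp \/ b = empty_comp >].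

(* The entry of [c] at [(i, j)], extended by the neutral element outside of the
   matrix. *)
Definition entry c (i j : nat) : M :=
  match insub i, insub j with
  | Some i', Some j' => mx c i' j'
  | _, _ => mone
  end.

Lemma entry_mx c (i : 'I_(nrows c)) (j : 'I_(ncols c)) : entry c i j = mx c i j.
Proof. by rewrite /entry !valK. Qed.

Lemma entry_outr c i j : (nrows c <= i)%N -> entry c i j = mone.
Proof. by move=> h; rewrite /entry insubN // -leqNgt. Qed.

Lemma entry_outc c i j : (ncols c <= j)%N -> entry c i j = mone.
Proof.
move=> h; have E : insub j = None :> option 'I_(ncols c) by rewrite insubN // -leqNgt.
by rewrite /entry E; case: insub.
Qed.

Lemma mcomp_ext a b : nrows a = nrows b -> ncols a = ncols b ->
  (forall i j, (i < nrows a)%N -> (j < ncols a)%N -> entry a i j = entry b i j) ->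
  a = b.
Proof.
case: a b => m n A hA [m' n' B hB] /= em en.
case: m' / em B hB => B; case: n' / en B => B hB /= E.
suff eAB : A = B by case: B / eAB hB {E} => hB; rewrite (bool_irrelevance hA hB).
apply/matrixP => i j; have := E i j (ltn_ord i) (ltn_ord j).
by rewrite (entry_mx (c := MComp hA) i j) (entry_mx (c := MComp hB) i j).
Qed.

Lemma entry_diag a b i j : entry (diag a b) i j =
  if (i < nrows a)%N then if (j < ncols a)%N then entry a i j else mone
  else if (j < ncols a)%N then mone else entry b (i - nrows a) (j - ncols a).
Proof.
have [hi|hi] := ltnP i (nrows (diag a b)); last first.
  rewrite entry_outr //; rewrite /= in hi.
  rewrite ltnNge (leq_trans (leq_addr _ _) hi) /=; case: ifP => // _.
  by rewrite entry_outr // leq_subRL // (leq_trans (leq_addr _ _) hi).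
have [hj|hj] := ltnP j (ncols (diag a b)); last first.
  rewrite entry_outc //; rewrite /= in hj.
  rewrite [(j < _)%N]ltnNge (leq_trans (leq_addr _ _) hj) /=; case: ifP => // _.
  by rewrite entry_outc // leq_subRL // (leq_trans (leq_addr _ _) hj).
rewrite (entry_mx (Ordinal hi) (Ordinal hj)) /= /diag_block.
case: (splitP (Ordinal hi)) => k /= ek; case: (splitP (Ordinal hj)) => l /= el.
- rewrite (_ : Ordinal hi = lshift _ k); last exact: val_inj.
  rewrite (_ : Ordinal hj = lshift _ l); last exact: val_inj.
  by rewrite block_mxEul ek el entry_mx.
- rewrite (_ : Ordinal hi = lshift _ k); last exact: val_inj.
  rewrite (_ : Ordinal hj = rshift _ l); last exact: val_inj.
  by rewrite block_mxEur mxE.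
- rewrite (_ : Ordinal hi = rshift _ k); last exact: val_inj.
  rewrite (_ : Ordinal hj = lshift _ l); last exact: val_inj.
  by rewrite block_mxEdl mxE.
- rewrite (_ : Ordinal hi = rshift _ k); last exact: val_inj.
  rewrite (_ : Ordinal hj = rshift _ l); last exact: val_inj.
  by rewrite block_mxEdr ek el !addKn entry_mx.
Qed.

Lemma row_nontrivial c i : (i < nrows c)%N ->
  exists2 j, (j < ncols c)%N & entry c i j != mone.
Proof.
move=> hi; have [/(_ (Ordinal hi))[j hj] _] := no_trivial_lineP _ (mxP c).
by exists j => //; rewrite (entry_mx (Ordinal hi)).
Qed.

Lemma col_nontrivial c j : (j < ncols c)%N ->
  exists2 i, (i < nrows c)%N & entry c i j != mone.
Proof.
move=> hj; have [_ /(_ (Ordinal hj))[i hi]] := no_trivial_lineP _ (mxP c).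
by exists i => //; rewrite (entry_mx i (Ordinal hj)).
Qed.

Lemma nrows_eq0 c : (nrows c == 0)%N = (c == empty_comp).
Proof.
apply/eqP/eqP => [h|-> //].
apply: mcomp_ext => //=; last by rewrite h.
case h' : (ncols c) => [//|n].
by have [|i] := @col_nontrivial c 0%N; rewrite ?h' // h.
Qed.

Lemma diage a : diag a empty_comp = a.
Proof.
apply: mcomp_ext; rewrite /= ?addn0 // => i j hi hj.
by rewrite entry_diag hi hj.
Qed.

Lemma diagA a b c : diag a (diag b c) = diag (diag a b) c.
Proof.
apply: mcomp_ext; rewrite /= ?addnA // => i j _ _.
rewrite !entry_diag /= !subnDA.
have [hi|hi] := ltnP i (nrows a); have [hj|hj] := ltnP j (ncols a);
  rewrite ?(leq_trans hi (leq_addr _ _)) ?(leq_trans hj (leq_addr _ _)) //.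
- by case: ifP.
- by case: ifP.
by rewrite -(ltn_subLR _ hi) -(ltn_subLR _ hj).
Qed.

Lemma diag_inj_size a b u v : diag a u = diag b v ->
  nrows a = nrows b -> ncols a = ncols b -> a = b /\ u = v.
Proof.
move=> E em en.
have ent i j : entry (diag a u) i j = entry (diag b v) i j by rewrite E.
have [Er Ec] : (nrows a + nrows u)%N = (nrows b + nrows v)%N /\
  (ncols a + ncols u)%N = (ncols b + ncols v)%N.
  by split; [move: (congr1 (@nrows d) E) | move: (congr1 (@ncols d) E)].
split; apply: mcomp_ext => //.
- by move=> i j hi hj; have := ent i j; rewrite !entry_diag -em -en hi hj.
- by apply/eqP; rewrite -(eqn_add2l (nrows a)) Er em.
- by apply/eqP; rewrite -(eqn_add2l (ncols a)) Ec en.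
move=> i j _ _; have := ent (nrows a + i)%N (ncols a + j)%N.
by rewrite !entry_diag -em -en !ltnNge !leq_addr /= !addKn.
Qed.

Lemma diag_con_size a b u v : connected b -> a != empty_comp ->
  diag a u = diag b v -> (nrows b <= nrows a)%N.
Proof.
move=> /andP[bn0 /asboolP cb] an0 E; rewrite leqNgt; apply/negP => lt.
have ent i j : entry (diag a u) i j = entry (diag b v) i j by rewrite E.
have ltc : (ncols a < ncols b)%N.
  have [j hj nj] := row_nontrivial lt; rewrite ltnNge; apply/negP => le.
  move: nj; have := ent (nrows a) j; rewrite !entry_diag ltnn lt hj.
  by rewrite (leq_trans hj le) => <-; rewrite eqxx.
pose A := \matrix_(i < nrows b - nrows a, j < ncols b - ncols a)
  entry b (nrows a + i) (ncols a + j).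
have hA : no_trivial_line A.
  apply/no_trivial_lineP; split=> k.
    have h : (nrows a + k < nrows b)%N by rewrite -ltn_subRL.
    have [j hj nj] := row_nontrivial h.
    have := ent (nrows a + k)%N j; rewrite !entry_diag h hj ltnNge leq_addr /=.
    case: ltnP => [hj' e1|hj' _]; first by rewrite -e1 eqxx in nj.
    have hj2 : (j - ncols a < ncols b - ncols a)%N by rewrite ltn_sub2r.
    by exists (Ordinal hj2); rewrite mxE /= subnKC.
  have h : (ncols a + k < ncols b)%N by rewrite -ltn_subRL.
  have [i hi ni] := col_nontrivial h.
  have := ent i (ncols a + k)%N; rewrite !entry_diag h hi [(_ + _ < _)%N]ltnNge leq_addr /=.
  case: ltnP => [hi' e1|hi' _]; first by rewrite -e1 eqxx in ni.
  have hi2 : (i - nrows a < nrows b - nrows a)%N by rewrite ltn_sub2r.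
  by exists (Ordinal hi2); rewrite mxE /= subnKC.
have Eb : b = diag a (MComp hA).
  apply: mcomp_ext; rewrite /= ?subnKC ?(ltnW lt) ?(ltnW ltc) // => i j hi hj.
  have := ent i j; rewrite !entry_diag hi hj.
  case: ltnP => hi'; case: ltnP => hj' // _.
  have hi2 : (i - nrows a < nrows b - nrows a)%N by rewrite ltn_sub2r.
  have hj2 : (j - ncols a < ncols b - ncols a)%N by rewrite ltn_sub2r.
  rewrite (entry_mx (c := MComp hA) (Ordinal hi2) (Ordinal hj2)) /= mxE /=.
  by rewrite !subnKC.
have [/eqP|/eqP] := cb _ _ Eb; first by rewrite (negPf an0).
by rewrite -nrows_eq0 /= subn_eq0 leqNgt lt.
Qed.

Lemma diag_con_inj a b u v : connected a -> connected b ->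
  diag a u = diag b v -> a = b /\ u = v.
Proof.
move=> ca cb E.
have an0 : a != empty_comp by case/andP: ca.
have bn0 : b != empty_comp by case/andP: cb.
have em : nrows a = nrows b.
  apply/eqP; rewrite eqn_leq (diag_con_size ca bn0 (esym E)).
  exact: diag_con_size cb an0 E.
have ent i j : entry (diag a u) i j = entry (diag b v) i j by rewrite E.
apply: diag_inj_size => //.
apply/eqP; rewrite eqn_leq [(ncols a <= _)%N]leqNgt [(ncols b <= _)%N]leqNgt.
apply/andP; split; apply/negP => /col_nontrivial[i hi /negP[]].
  rewrite em in hi; have := ent i (ncols b).
  by rewrite !entry_diag em hi ltnn; case: ltnP => [_ ->|h _]; rewrite // entry_outc.
have := ent i (ncols a).
by rewrite !entry_diag em hi ltnn; case: ltnP => [_ <-|h _]; rewrite // entry_outc.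
Qed.

End Comp.

Definition con_comp d := {c : mcomp d | connected c}.
HB.instance Definition _ d := Choice.on (con_comp d).

Section Blocks.
Variable d : nat.
Implicit Types (a : con_comp d) (c : mcomp d) (w : seq (con_comp d)).

Definition diags w : mcomp d := foldr (fun a c => diag (val a) c) (empty_comp d) w.

Lemma diags_cat w w' : diags (w ++ w') = diag (diags w) (diags w').
Proof.
elim: w => [|a w IH] /=; last by rewrite IH diagA.
by apply: mcomp_ext => //= i j _ _; rewrite entry_diag /= !subn0.
Qed.

Lemma diags_surj c : exists w, diags w == c.
Proof.
move: {2}(nrows c).+1 (ltnSn (nrows c)) => n; elim: n c => // n IH c.
rewrite ltnS => hc.
have [->|cn0] := eqVneq c (empty_comp d); first by exists [::].
have [cc|] := boolP (connected c).
  by exists [:: Sub c cc]; rewrite /= diage.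
rewrite negb_and cn0 /= => /asboolPn /existsNP[a] /existsNP[b].
move=> /not_implyP[E] /not_orP[/eqP an0 /eqP bn0].
move: an0 bn0; rewrite -!nrows_eq0 -!lt0n => an0 bn0.
have Er : nrows c = (nrows a + nrows b)%N by rewrite E.
have [|wa /eqP ea] := IH a.
  by apply: leq_trans hc; rewrite Er -addn1 leq_add2l.
have [|wb /eqP eb] := IH b.
  by apply: leq_trans hc; rewrite Er -add1n leq_add2r.
by exists (wa ++ wb); rewrite diags_cat ea eb E.
Qed.

Lemma diags_inj : injective diags.
Proof.
elim=> [|a w IH] [|b w'] //= E.
- have /andP[] := valP b; rewrite -nrows_eq0 -lt0n => h _.
  by move: (congr1 (@nrows d) E) h => /=; case: (nrows _).
- have /andP[] := valP a; rewrite -nrows_eq0 -lt0n => h _.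
  by move: (congr1 (@nrows d) E) h => /=; case: (nrows _).
by have [/val_inj -> /IH ->] := diag_con_inj (valP a) (valP b) E.
Qed.

(* The unique word of connected compositions with block diagonal [c]. *)
Definition blocks c : seq (con_comp d) := xchoose (diags_surj c).

Lemma blocksK : cancel blocks diags.
Proof. by move=> c; apply/eqP; apply: (xchooseP (diags_surj c)). Qed.

Lemma diagsK : cancel diags blocks.
Proof. by move=> w; apply: diags_inj; rewrite blocksK. Qed.

End Blocks.

(* Locked, as unification would otherwise unfold the finite support functions
   when comparing two basis elements. *)
HB.lock Definition basis (K : comNzRingType) d (c : mcomp d) : {malg K[mcomp d]} :=
  << c >>.

Section Products.
Variables (K : comNzRingType) (d : nat).
Local Notation M := {cmonom 'I_d}.
Local Notation H := {malg K[mcomp d]}.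
Implicit Types a b c : mcomp d.

Definition linear_ext (f : mcomp d -> H) (x : H) : H :=
  \sum_(a <- msupp x) x@_a *: f a.

Definition bilinear_ext (f : mcomp d -> mcomp d -> H) (x y : H) : H :=
  linear_ext (fun a => linear_ext (f a) y) x.

Lemma linear_extU f a : linear_ext f (basis K a) = f a.
Proof.
by rewrite basis.unlock /linear_ext msuppU oner_eq0 big_seq_fset1 mcoeffU eqxx scale1r.
Qed.

Lemma bilinear_extU f a b : bilinear_ext f (basis K a) (basis K b) = f a b.
Proof. by rewrite /bilinear_ext !linear_extU. Qed.

Definition unit_H : H := basis K (empty_comp d).

Definition diag_H (a : mcomp d) : H -> H := linear_ext (fun c => basis K (diag a c)).

Fixpoint block_shuffle_words (w : seq (con_comp d)) : seq (con_comp d) -> H :=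
  fix aux (w' : seq (con_comp d)) : H :=
    match w, w' with
    | [::], _ => basis K (diags w')
    | _, [::] => basis K (diags w)
    | a :: u, b :: v =>
        diag_H (val a) (block_shuffle_words u w') + diag_H (val b) (aux v)
    end.

Definition block_shuffle : H -> H -> H :=
  bilinear_ext (fun a b => block_shuffle_words (blocks a) (blocks b)).

Lemma block_shuffle0l b : block_shuffle unit_H (basis K b) = basis K b.
Proof.
rewrite /block_shuffle bilinear_extU -[empty_comp d]/(diags [::]) diagsK.
by rewrite -{2}(blocksK b); case: (blocks b).
Qed.

Lemma block_shuffle0r a : block_shuffle (basis K a) unit_H = basis K a.
Proof.
rewrite /block_shuffle bilinear_extU -[empty_comp d]/(diags [::]) diagsK.
by rewrite -{2}(blocksK a); case: (blocks a).
Qed.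

Lemma block_shuffleE a b u v : connected a -> connected b ->
  block_shuffle (basis K (diag a u)) (basis K (diag b v)) =
    diag_H a (block_shuffle (basis K u) (basis K (diag b v))) +
    diag_H b (block_shuffle (basis K (diag a u)) (basis K v)).
Proof.
move=> ca cb; rewrite /block_shuffle !bilinear_extU.
have Eblocks (x : mcomp d) (cx : connected x) (w : mcomp d) :
  blocks (diag x w) = Sub x cx :: blocks w by rewrite -[RHS]diagsK /= blocksK.
by rewrite (Eblocks _ ca) (Eblocks _ cb).
Qed.

Definition increasing_on_blocks m s j (f : 'I_(m + s) -> 'I_j) : bool :=
  [forall i : 'I_m, forall i' : 'I_m,
     (i < i')%N ==> (f (lshift s i) < f (lshift s i'))%N] &&
  [forall i : 'I_s, forall i' : 'I_s,
     (i < i')%N ==> (f (rshift m i) < f (rshift m i'))%N].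

Definition sh m s : {set 'S_(m + s)} := [set p : 'S_(m + s) | increasing_on_blocks p].

Definition shuffle_mx m n (D : 'M[M]_(m, n)) (p : 'S_m) (q : 'S_n) : 'M[M]_(m, n) :=
  \matrix_(u, v) D (p^-1%g u) (q^-1%g v).

Lemma shuffle_mx_subproof m n (D : 'M[M]_(m, n)) p q :
  no_trivial_line D -> no_trivial_line (shuffle_mx D p q).
Proof.
move=> /no_trivial_lineP[r c]; apply/no_trivial_lineP; split=> k.
  by have [j hj] := r (p^-1%g k); exists (q j); rewrite mxE permK.
by have [i hi] := c (q^-1%g k); exists (p i); rewrite mxE permK.
Qed.

Definition shuffle_comp c (p : 'S_(nrows c)) (q : 'S_(ncols c)) : mcomp d :=
  MComp (shuffle_mx_subproof p q (mxP c)).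

Definition shuffle : H -> H -> H := bilinear_ext (fun a b =>
  if a == empty_comp d then basis K b
  else if b == empty_comp d then basis K a
  else \sum_(p in sh (nrows a) (nrows b)) \sum_(q in sh (ncols a) (ncols b))
         basis K (shuffle_comp (c := diag a b) p q)).

Definition surjectiveb m j (f : 'I_m -> 'I_j) : bool :=
  [forall x, exists u, f u == x].

Definition qsh m s j :=
  {f : {ffun 'I_(m + s) -> 'I_j} | surjectiveb f && increasing_on_blocks f}.
HB.instance Definition _ m s j := Finite.on (qsh m s j).

Definition quasi_shuffle_mx m n j k (D : 'M[M]_(m, n))
    (p : 'I_m -> 'I_j) (q : 'I_n -> 'I_k) : 'M[M]_(j, k) :=
  \matrix_(x, y) \big[mmul/mone]_(u | p u == x) \big[mmul/mone]_(v | q v == y) D u v.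

Lemma quasi_shuffle_mx_subproof m n j k (D : 'M[M]_(m, n))
    (p : 'I_m -> 'I_j) (q : 'I_n -> 'I_k) :
  surjectiveb p -> surjectiveb q ->
  no_trivial_line D -> no_trivial_line (quasi_shuffle_mx D p q).
Proof.
move=> /forallP sp /forallP sq /no_trivial_lineP[r c].
have key u v : D u v != mone -> quasi_shuffle_mx D p q (p u) (q v) != mone.
  apply: contraNneq; rewrite mxE (bigD1 u) //= (bigD1 v) //= => E.
  by have [/(@unitm M)[-> _] _] := unitm _ _ E.
apply/no_trivial_lineP; split=> z.
  have /existsP[u /eqP <-] := sp z; have [v hv] := r u.
  by exists (q v); apply: key.
have /existsP[v /eqP <-] := sq z; have [u hu] := c v.
by exists (p u); apply: key.
Qed.

Lemma qsh_surj m s j (p : qsh m s j) : surjectiveb (val p).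
Proof. by have /andP[] := valP p. Qed.

Definition quasi_shuffle_comp a b j k
    (p : qsh (nrows a) (nrows b) j) (q : qsh (ncols a) (ncols b) k) : mcomp d :=
  MComp (quasi_shuffle_mx_subproof (qsh_surj p) (qsh_surj q) (mxP (diag a b))).

(* There is no surjection from [m + s] elements onto more than [m + s], so that
   the sums over all [j, k >= 1] may be truncated. *)
Definition quasi_shuffle : H -> H -> H := bilinear_ext (fun a b =>
  if a == empty_comp d then basis K b
  else if b == empty_comp d then basis K a
  else \sum_(1 <= j < (nrows a + nrows b).+1)
       \sum_(1 <= k < (ncols a + ncols b).+1)
       \sum_(p : qsh (nrows a) (nrows b) j)
       \sum_(q : qsh (ncols a) (ncols b) k) basis K (quasi_shuffle_comp p q)).

End Products.

Section Lyndon.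
Variables (T : eqType) (lt : rel T).

Fixpoint lexlt (s t : seq T) : bool :=
  match s, t with
  | _, [::] => false
  | [::], _ :: _ => true
  | x :: s', y :: t' => lt x y || (x == y) && lexlt s' t'
  end.

Definition lyndon (w : seq T) : bool :=
  (w != [::]) && all (fun i => lexlt w (drop i w)) (iota 1 (size w).-1).
End Lyndon.

Definition lyndon_word (T : choiceType) (lt : rel T) := {w : seq T | lyndon lt w}.
HB.instance Definition _ T lt := Choice.on (@lyndon_word T lt).

Definition lyndon_basis (K : comNzRingType) d (lt : rel (con_comp d))
    (w : lyndon_word lt) : {malg K[mcomp d]} :=
  basis K (diags (val w)).

(* [{malg K[{cmonom I}]}] is the polynomial algebra on the variables
   [<< ucm i >>]. These variables generate it, so that the first three
   conditions characterize [phi] as the canonical map to [(V, mul, one)]. *)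
Definition freely_generates (K : comNzRingType) (V : lmodType K)
    (mul : V -> V -> V) (one : V) (I : choiceType) (B : I -> V) : Prop :=
  exists phi : {linear {malg K[{cmonom I}]} -> V},
    [/\ phi 1 = one,
        {morph phi : f g / f * g >-> mul f g},
        forall i, phi << ucm i >> = B i
      & bijective phi].

(* Main.v *)
Require Import Defs.
From HB Require Import structures.
From mathcomp Require Import all_boot all_order all_algebra all_fingroup finmap.
From mathcomp Require Import boolp monalg.

Set Implicit Arguments.
Unset Strict Implicit.
Unset Printing Implicit Defensive.

(** Read a composition as the word of its connected blocks. Filter the free
    module on the compositions by the number of blocks. Each of the three
    products maps a pair of compositions to a sum of compositions, with
    multiplicities, that either have fewer blocks than the two factors together
    or whose blocks interleave the blocks of the factors; moreover the
    concatenation occurs at least once. So all three are perturbations, by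
    terms of smaller filtration, of the shuffle product of words, and one
    triangularity argument treats them together (lyndon_freely_generates).

    Triangularity is Radford's theorem on the shuffle algebra. A word is the
    concatenation of a unique lexicographically decreasing sequence of Lyndon
    words (lyndon_factorization, decreasing_flatten_inj), so monomials in the
    Lyndon words correspond to words. If w is the word of a monomial, then among
    all interleavings of its factors w is the largest (shuf_le_merge). Hence the
    product of the factors is a positive integer multiple of the basis element
    w plus terms that are shorter, or have the same letters and are smaller
    (lyndon_product_leading). Positive integers are invertible in K, and only
    finitely many words share their letters with w, which gives bijectivity.

    It remains to see that the products fit this setting.

    - Quasi-shuffle: commutativity and associativity follow from multiplicative
      maps into commutative monoid algebras that together are injective. They
      send a to the sum of all ways to spread the rows and columns of a, in order, over an N by N
      matrix; such matrices multiply entrywise, and overlaying a placement of a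
      and one of b gives a placement of a unique term of their quasi-shuffle
      (series_mul, series_inj).
    - Blocks: if a term c of the quasi-shuffle of a and b is block diagonal, then
      the parts of a and b inside of each diagonal block of c are themselves
      diagonal parts of a and b, since products in a free monoid are trivial only
      if both factors are. So every connected block of c uses at least one block
      of a or b, and equals it if it uses only one (interleaves_diags).
    - Shuffle: it is the part of largest size of the quasi-shuffle, from which it
      inherits commutativity and associativity (size_part_quasi_shuffle). Its
      terms are overlays as well, so the argument on blocks applies to them.
    - Block shuffle: its recursion is that of the shuffle of words. *)

(** * Interleavings of words *)

(** Multiplicities are left out: they are the business of sums of basis elements,
    and the order arguments only ask which words occur. *)
Inductive shuf (T : Type) : seq T -> seq T -> seq T -> Prop :=
| ShufNil : shuf [::] [::] [::]
| ShufL x u v w of shuf u v w : shuf (x :: u) v (x :: w)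
| ShufR x u v w of shuf u v w : shuf u (x :: v) (x :: w).

Section Shuf.
Variable T : eqType.
Implicit Types u v w : seq T.

Lemma shuf_sym u v w : shuf u v w -> shuf v u w.
Proof. by elim=> *; constructor. Qed.

Lemma shuf0w w : shuf [::] w w.
Proof. by elim: w => *; constructor. Qed.

Lemma shuf_perm u v w : shuf u v w -> perm_eq w (u ++ v).
Proof.
elim=> [|x {}u {}v {}w _ IH|x {}u {}v {}w _ IH] //=; first by rewrite perm_cons.
by rewrite perm_sym -cat1s perm_catCA /= perm_cons perm_sym.
Qed.

Lemma shuf_size u v w : shuf u v w -> size w = (size u + size v)%N.
Proof. by move/shuf_perm/perm_size; rewrite size_cat. Qed.
End Shuf.

(** * Lyndon words and the lexicographic order *)

Section Lex.
Variables (T : eqType) (lt : rel T).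
Hypotheses (lt_irr : irreflexive lt) (lt_trans : transitive lt)
  (lt_total : forall a b : T, a != b -> lt a b || lt b a).
Implicit Types (a : T) (u v w l p x y : seq T) (s t us : seq (seq T)).
Local Notation lexlt := (lexlt lt).
Local Notation lyndon := (lyndon lt).

Definition lexge u v := ~~ lexlt u v.

Lemma lexltw0 u : lexlt u [::] = false.
Proof. by case: u. Qed.

Lemma lexlt_irr : irreflexive lexlt.
Proof. by elim=> //= a u ->; rewrite lt_irr andbF. Qed.

Lemma lexlt_trans : transitive lexlt.
Proof.
move=> v u; elim: u v => [|a u IH] [|b v] [|c w] //=.
case/orP=> [ab|/andP[/eqP<- uv]]; case/orP=> [bc|/andP[/eqP<- vw]].
- by rewrite (lt_trans ab bc).
- by rewrite ab.
- by rewrite bc.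
- by rewrite eqxx (IH _ _ uv vw) orbT.
Qed.

Lemma lexlt_total u v : u != v -> lexlt u v || lexlt v u.
Proof.
elim: u v => [|a u IH] [|b v] //=.
have [<-|ab _] := eqVneq a b; last by case/orP: (lt_total ab) => ->; rewrite ?orbT.
by rewrite eqseq_cons !eqxx /= lt_irr => /IH.
Qed.

Lemma lexlt_asym u v : lexlt u v -> lexlt v u = false.
Proof. by move=> uv; apply/negP => /(lexlt_trans uv); rewrite lexlt_irr. Qed.

Lemma lexltW u v : lexlt u v -> lexge v u.
Proof. by move/lexlt_asym; rewrite /lexge => ->. Qed.

Lemma lexge_refl u : lexge u u.
Proof. by rewrite /lexge lexlt_irr. Qed.

Lemma lexge_eqVlt u v : lexge u v -> u = v \/ lexlt v u.
Proof.
rewrite /lexge; have [->|/lexlt_total/orP[->|->]] := eqVneq u v; by [left|right|].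
Qed.

Lemma lexlt_ge_trans u v w : lexlt u v -> lexge w v -> lexlt u w.
Proof. by move=> uv /lexge_eqVlt[->//|]; apply: lexlt_trans. Qed.

Lemma lexge_lt_trans u v w : lexge v u -> lexlt v w -> lexlt u w.
Proof. by case/lexge_eqVlt => [->//|]; apply: lexlt_trans. Qed.

Lemma lexge_trans : transitive lexge.
Proof.
move=> v u w uv /lexge_eqVlt[<-//|wv].
by apply: lexltW; apply: lexlt_ge_trans wv uv.
Qed.

Lemma lexge_total : total lexge.
Proof. by move=> u v; rewrite /lexge; case: (boolP (lexlt u v)) => // /lexlt_asym ->. Qed.

Lemma lexge_anti : antisymmetric lexge.
Proof.
move=> u v /andP[uv /negP vu]; by case: (lexge_eqVlt uv).
Qed.

Lemma lexlt_cat2l p u v : lexlt (p ++ u) (p ++ v) = lexlt u v.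
Proof. by elim: p => //= a p IH; rewrite lt_irr eqxx. Qed.

Lemma lexge_catl u v : lexge (u ++ v) u.
Proof. by rewrite /lexge -{2}(cats0 u) lexlt_cat2l lexltw0. Qed.

(** The two ways of being smaller: only the second one survives appending words. *)
Lemma lexlt_prefix u v : lexlt u v ->
  (exists z, v = u ++ z /\ z != [::]) \/ (forall x y, lexlt (u ++ x) (v ++ y)).
Proof.
elim: u v => [|a u IH] [|b v] //=; first by left; exists (b :: v).
case/orP=> [ab|/andP[/eqP<- /IH[[z [-> z0]]|E]]].
- by right=> x y; rewrite /= ab.
- by left; exists z.
- by right=> x y; rewrite /= eqxx E orbT.
Qed.

Lemma lexlt_cat u v x y : lexlt u v -> (size v <= size u)%N ->
  lexlt (u ++ x) (v ++ y).
Proof.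
case/lexlt_prefix=> [[z [-> z0]]|E _]; last exact: E.
by rewrite size_cat -{2}[size u]addn0 leq_add2l leqn0 size_eq0 (negPf z0).
Qed.

Lemma lyndon_suffix p l : p != [::] -> l != [::] -> lyndon (p ++ l) -> lexlt (p ++ l) l.
Proof.
move=> p0 l0 /andP[_ /allP/(_ (size p))]; rewrite drop_size_cat //; apply.
rewrite mem_iota lt0n size_eq0 p0 size_cat /= add1n.
by case: l l0 => // a l _; rewrite /= addnS /= ltnS leq_addr.
Qed.

Lemma lyndonI l : l != [::] ->
  (forall p z, p != [::] -> z != [::] -> l = p ++ z -> lexlt l z) -> lyndon l.
Proof.
move=> l0 H; rewrite /Defs.lyndon l0; apply/allP => i; rewrite mem_iota add1n => /andP[i1 i2].
have il : (i < size l)%N by case: (l) l0 i2.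
apply: (H (take i l)); rewrite ?cat_take_drop // -size_eq0.
  by rewrite size_take il -lt0n.
by rewrite size_drop subn_eq0 -ltnNge.
Qed.

Lemma lyndon_neq0 l : lyndon l -> l != [::].
Proof. by case/andP. Qed.

Lemma lyndon1 a : lyndon [:: a].
Proof. by []. Qed.

(** A suffix of [l ++ m] longer than [m] starts with a proper suffix of [l], which is
    larger than [l] and shorter, so they differ at some letter; suffixes of [m] are at
    least [m], which is larger than [l ++ m]. *)
Lemma lyndon_cat l m : lyndon l -> lyndon m -> lexlt l m -> lyndon (l ++ m).
Proof.
move=> Ll Lm lm; have l0 := lyndon_neq0 Ll; have m0 := lyndon_neq0 Lm.
have lm_m : lexlt (l ++ m) m.
  case: (lexlt_prefix lm) => [[z [E z0]]|]; last by move/(_ m [::]); rewrite cats0.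
  by rewrite [X in lexlt _ X]E lexlt_cat2l E; apply: lyndon_suffix; rewrite -?E.
apply: lyndonI => [|p z p0 z0 E]; first by rewrite -size_eq0 size_cat addn_eq0 size_eq0 (negPf l0).
have [le_pl|lt_lp] := leqP (size p) (size l).
  have [q El] : exists q, l = p ++ q.
    exists (drop (size p) l); rewrite -{1}(cat_take_drop (size p) l); congr (_ ++ _).
    by move/(congr1 (take (size p))): E; rewrite take_cat take_size_cat // ltn_neqAle le_pl;
       case: eqP => // ->; rewrite subnn take0 cats0 take_size.
  have Ez : z = q ++ m by move: E; rewrite El -catA => /eqP; rewrite eqseq_cat // eqxx => /eqP.
  have [q0|q0] := eqVneq q [::]; first by rewrite Ez q0.
  rewrite Ez; apply: lexlt_cat; last by rewrite El size_cat leq_addl.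
  by rewrite El; apply: lyndon_suffix; rewrite -?El.
have [q [Em q0]] : exists q, m = q ++ z /\ q != [::].
  exists (drop (size l) p); split; last by rewrite -size_eq0 size_drop subn_eq0 -ltnNge.
  move/(congr1 (drop (size l))): E; rewrite drop_size_cat // drop_cat lt_lp //.
by apply: lexlt_trans lm_m _; rewrite Em; apply: lyndon_suffix; rewrite -?Em.
Qed.

Definition decreasing s := sorted lexge s && all lyndon s.

Lemma decreasing_cons l s : lyndon l -> decreasing s ->
  exists2 s', decreasing s' & flatten s' = l ++ flatten s.
Proof.
elim: s l => [|m s IH] l Ll ds; first by exists [:: l]; rewrite ?/decreasing /= ?Ll.
have /andP[/= ss /andP[Lm Ls]] := ds.
have [lm|ge_lm] := boolP (lexlt l m); last first.
  by exists (l :: m :: s) => //; rewrite /decreasing /= [lexge l m]ge_lm ss Ll Lm.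
have [|s' ds' Es'] := IH (l ++ m) (lyndon_cat Ll Lm lm).
  by rewrite /decreasing Ls (path_sorted ss).
by exists s' => //; rewrite Es' -catA.
Qed.

(** Each new letter is a Lyndon word, absorbing the factors after it as long as they are
    larger than what has been built. *)
Lemma lyndon_factorization w : exists2 s, decreasing s & flatten s = w.
Proof.
elim: w => [|a w [s ds <-]]; first by exists [::].
exact: (decreasing_cons (lyndon1 a)).
Qed.

(** The last factor met by [z] starts with a suffix of [l], and [l] is smaller than its
    suffixes. *)
Lemma lyndon_suffix_prefix l p z s y : lyndon l -> p != [::] -> z != [::] ->
  l = p ++ z -> flatten s = z ++ y -> exists2 m, m \in s & lexlt l m.
Proof.
elim: s p z => [|m s IH] p z Ll p0 z0 El /=; first by case: z z0 {El}.
move=> E; have lz : lexlt l z by rewrite El lyndon_suffix // -El.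
have [le_zm|lt_mz] := leqP (size z) (size m).
  exists m; rewrite ?mem_head //; apply: (lexlt_ge_trans lz).
  have -> : m = z ++ drop (size z) m; last exact: lexge_catl.
  rewrite -{1}(cat_take_drop (size z) m); congr (_ ++ _).
  move/(congr1 (take (size z))): E; rewrite take_cat take_size_cat // ltn_neqAle le_zm.
  by case: eqP => // ->; rewrite subnn take0 cats0 take_size.
pose z' := drop (size m) z.
have Ez : z = m ++ z'.
  rewrite -{1}(cat_take_drop (size m) z); congr (_ ++ _).
  by move/(congr1 (take (size m))): E; rewrite take_cat ltnn subnn take0 cats0 take_cat lt_mz.
have [||||m' m's lm'] := IH (p ++ m) z' Ll.
- by rewrite -size_eq0 size_cat addn_eq0 size_eq0 (negPf p0).
- by rewrite -size_eq0 size_drop subn_eq0 -ltnNge.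
- by rewrite -catA -Ez.
- by move: E; rewrite Ez -catA => /eqP; rewrite eqseq_cat // eqxx => /eqP.
by exists m'; rewrite // inE m's orbT.
Qed.

Lemma decreasing_head l s : decreasing (l :: s) ->
  [/\ lyndon l, decreasing s & {in s, forall m, lexge l m}].
Proof.
case/andP=> /= ss /andP[Ll Ls]; split=> //; first by rewrite /decreasing (path_sorted ss).
by apply/allP; apply: order_path_min ss; apply: lexge_trans.
Qed.

(** If the first factors differ in length, say [l = m ++ z], then [z] runs into a factor
    larger than [l]; but all factors there are at most [m], a prefix of [l]. *)
Lemma decreasing_flatten_inj s s' : decreasing s -> decreasing s' ->
  flatten s = flatten s' -> s = s'.
Proof.
have aux l m t t' : decreasing (l :: t) -> decreasing (m :: t') ->
    flatten (l :: t) = flatten (m :: t') -> (size m < size l)%N -> False.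
  move=> /decreasing_head[Ll _ _] /decreasing_head[Lm _ gem] /= E lt_ml.
  pose z := drop (size m) l.
  have El : l = m ++ z.
    rewrite -{1}(cat_take_drop (size m) l); congr (_ ++ _).
    by move/(congr1 (take (size m))): E; rewrite take_cat lt_ml take_size_cat.
  have Ez : flatten t' = z ++ flatten t.
    by move: E; rewrite El -catA => /eqP; rewrite eqseq_cat // eqxx => /eqP.
  have z0 : z != [::] by rewrite -size_eq0 size_drop subn_eq0 -ltnNge.
  have [m' /gem mm' lm'] := lyndon_suffix_prefix Ll (lyndon_neq0 Lm) z0 El Ez.
  have := lexlt_ge_trans lm' mm'; apply/negP.
  by rewrite [X in lexlt X]El -/(lexge _ _) lexge_catl.
elim: s s' => [|l s IH] [|m s'] // ds ds' E.
- by have [/lyndon_neq0 + _ _] := decreasing_head ds'; case: (m) E.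
- by have [/lyndon_neq0 + _ _] := decreasing_head ds; case: (l) E.
have [lm|lm|lm] := ltngtP (size l) (size m).
- by case: (aux _ _ _ _ ds' ds (esym E)).
- by case: (aux _ _ _ _ ds ds' E).
move/eqP: E; rewrite /= eqseq_cat // => /andP[/eqP -> /eqP E].
have [_ ds1 _] := decreasing_head ds; have [_ ds2 _] := decreasing_head ds'.
by rewrite (IH _ ds1 ds2 E).
Qed.

Lemma lexge_sorted_eq s t : sorted lexge s -> sorted lexge t -> perm_eq s t -> s = t.
Proof. exact: (sorted_eq lexge_trans lexge_anti). Qed.

(** If [l = p ++ z], cancel [p]: the suffix [z] exceeds [l] and is shorter, so the comparison
    is settled before either of them ends. *)
Lemma lyndon_swap p l x y : p != [::] -> lyndon l -> lexlt p l ->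
  lexlt (p ++ l ++ x) (l ++ y).
Proof.
move=> p0 Ll /lexlt_prefix[[z [E z0]]|]; last exact.
rewrite [l in X in lexlt _ X]E -catA lexlt_cat2l; apply: lexlt_cat.
  by rewrite [X in lexlt X]E lyndon_suffix -?E.
by rewrite E size_cat leq_addl.
Qed.

(** The factors [us] of what remains of [l] after deleting a prefix [p] are all larger than
    [l]. Sorting them into [t] and putting [p] back in front yields at most the word obtained
    by sorting [l] itself into [t]. *)
Lemma merge_lyndon_le l p us t : lyndon l -> p != [::] -> l = p ++ flatten us ->
  {in us, forall u, lexlt l u} -> decreasing t ->
  lexge (flatten (merge lexge [:: l] t)) (p ++ flatten (merge lexge us t)).
Proof.
move=> Ll + + + dt; elim: us p => [|u us IH] p p0.
  rewrite cats0 => <- _; case: t dt => [|m t]; first by rewrite /= cats0 lexge_refl.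
  case/decreasing_head=> Lm _ _ /=; case: ifPn => [_|/negPn lm]; first exact: lexge_refl.
  by apply: lexltW; apply: lyndon_swap => //; apply: lyndon_neq0.
move=> El gel; case: t dt IH => [|m t] dt IH; first by rewrite /= cats0 El lexge_refl.
have [Lm _ _] := decreasing_head dt.
have lu : lexlt l u by apply: gel; rewrite mem_head.
rewrite [merge lexge (u :: us) _]/=; case: ifPn => [_|/negPn um].
  rewrite /= catA; apply: IH => [||v vus].
  - by rewrite -size_eq0 size_cat addn_eq0 size_eq0 (negPf p0).
  - by rewrite El /= catA.
  - by apply: gel; rewrite inE vus orbT.
(* The factor [m] now precedes everything else on both sides, except for [p] on the left. *)
have lm := lexlt_trans lu um.
rewrite /= [lexge l m]/lexge lm /=; apply: lexltW; apply: lyndon_swap => //.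
by apply: lexge_lt_trans lm; rewrite El lexge_catl.
Qed.

(** The smallest factor of [l] is its last one, a proper suffix of [a :: l]. *)
Lemma lyndon_suffix_factor a l : lyndon (a :: l) ->
  exists us, [/\ decreasing us, flatten us = l & {in us, forall u, lexlt (a :: l) u}].
Proof.
move=> Ll; have [us dus Eus] := lyndon_factorization l; exists us; split=> //.
case/lastP: us dus Eus => // us m dus; rewrite flatten_rcons => Eus u.
move: dus; rewrite /decreasing all_rcons => /andP[ss /andP[Lm _]].
have lm : lexlt (a :: l) m.
  by rewrite -Eus -cat_cons lyndon_suffix // ?lyndon_neq0 // cat_cons Eus.
rewrite mem_rcons inE => /predU1P[->//|/(nthP [::])[i li <-]].
apply: (lexlt_ge_trans lm).
have := sorted_leq_nth lexge_trans lexge_refl [::] ss.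
move=> /(_ i (size us)); rewrite !inE size_rcons ltnS (ltnW li) => /(_ isT (ltnSn _) isT).
by rewrite !nth_rcons li ltnn eqxx.
Qed.

Lemma decreasing_merge s t : decreasing s -> decreasing t -> decreasing (merge lexge s t).
Proof.
case/andP=> ss Ls /andP[st Lt]; rewrite /decreasing merge_sorted //=; last exact: lexge_total.
by rewrite (perm_all _ (permEl (perm_merge _ _ _))) all_cat Ls.
Qed.

(** Induction on the interleaving. Its first letter [a] is the first letter of some factor
    [a :: l]; the rest of the word interleaves words with known factorizations, once [l] has
    been factored, and [merge_lyndon_le] puts [a] back. *)
Lemma shuf_le_merge s t w : decreasing s -> decreasing t ->
  shuf (flatten s) (flatten t) w -> lexge (flatten (merge lexge s t)) w.
Proof.
elim: w s t => [|a w IH] s t ds dt H; first by rewrite /lexge lexltw0.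
(* Merging is symmetric, so [a] may be taken from the first word. *)
wlog [u Eu Hu] : s t ds dt H / exists2 u, flatten s = a :: u & shuf u (flatten t) w.
  move=> th; have : (exists2 u, flatten s = a :: u & shuf u (flatten t) w) \/
                    (exists2 u, flatten t = a :: u & shuf u (flatten s) w).
    by inversion H; [left; exists u | right; exists v => //; apply: shuf_sym].
  case=> [|h]; first exact: th.
  rewrite (@lexge_sorted_eq (merge lexge s t) (merge lexge t s)); first last.
  - by rewrite perm_merge perm_sym perm_merge perm_catC.
  - by case/andP: (decreasing_merge dt ds).
  - by case/andP: (decreasing_merge ds dt).
  by apply: th => //; apply: shuf_sym.
case: s ds {H} Eu => // l s /[dup] dls /decreasing_head[Ll ds gel].
case: l Ll dls gel => [|b l] // Ll dls gel /= [? Eu]; subst b u.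
have [us [dus Eus lus]] := lyndon_suffix_factor Ll.
have dust : decreasing (us ++ s).
  case/andP: dus => su Lu; case/andP: (ds) => ss Ls.
  rewrite /decreasing all_cat Lu Ls !andbT sorted_pairwise; last exact: lexge_trans.
  rewrite pairwise_cat -!sorted_pairwise ?su ?ss ?andbT; try exact: lexge_trans.
  apply/allrelP => x y /lus lx /gel ly; apply: lexltW; exact: lexge_lt_trans ly lx.
have dst := decreasing_merge ds dt.
have -> : merge lexge ((a :: l) :: s) t = merge lexge [:: a :: l] (merge lexge s t).
  apply: lexge_sorted_eq.
  - by case/andP: (decreasing_merge dls dt).
  - have dl : decreasing [:: a :: l] by rewrite /decreasing /= Ll.
    by case/andP: (decreasing_merge dl dst).
  - rewrite perm_merge perm_sym perm_merge /= perm_cons perm_merge //.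
have := IH _ _ dust dt; rewrite flatten_cat Eus => /(_ Hu).
have -> : merge lexge (us ++ s) t = merge lexge us (merge lexge s t).
  apply: lexge_sorted_eq.
  - by case/andP: (decreasing_merge dust dt).
  - by case/andP: (decreasing_merge dus dst).
  - by rewrite perm_merge perm_sym perm_merge -catA perm_cat2l perm_merge.
move=> le_w; apply: lexge_trans (merge_lyndon_le (p := [:: a]) Ll _ _ lus dst) _ => //.
  by rewrite Eus.
by rewrite /lexge /= lt_irr eqxx.
Qed.

Lemma shuf_lyndon_le l s w : decreasing (l :: s) -> shuf l (flatten s) w ->
  lexge (l ++ flatten s) w.
Proof.
move=> dls H; have [Ll ds _] := decreasing_head dls.
have := @shuf_le_merge [:: l] s w _ ds; rewrite /= cats0 {1}/decreasing /= Ll.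
move=> /(_ isT H); have -> // : merge lexge [:: l] s = l :: s.
by rewrite sorted_merge //; [apply: lexge_trans | case/andP: dls].
Qed.

(** Replace [v] by [v'] in the same positions: the first difference stays the first one. *)
Lemma shuf_lexlt u v v' w : shuf u v w -> size v = size v' -> lexlt v v' ->
  exists2 w', shuf u v' w' & lexlt w w'.
Proof.
move=> H; elim: H v' => [|x {}u {}v {}w _ IH|x {}u {}v {}w H IH] v' Es vv'.
- by case: v' Es vv'.
- by have [w' H' ww'] := IH _ Es vv'; exists (x :: w'); [constructor | rewrite /= eqxx ww' orbT].
case: v' Es vv' => //= y v' [Es] /orP[xy|/andP[/eqP<- vv']].
  have [w' H'] : exists w', shuf u v' w'.
    by elim: (u) => [|z u' [w' H']]; [exists v'; apply: shuf0w | exists (z :: w'); constructor].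
  by exists (y :: w'); [constructor | rewrite /= xy].
by have [w' H' ww'] := IH _ Es vv'; exists (x :: w'); [constructor | rewrite /= eqxx ww' orbT].
Qed.
End Lex.

Import GRing.Theory.
Local Open Scope ring_scope.

(** * Linear and bilinear extensions *)

Section LinearMaps.
Variables (K : comNzRingType) (I : choiceType) (V : lmodType K).
Implicit Types (f : I -> V) (x : {malg K[I]}).

Lemma linear_big (U W : lmodType K) (F : U -> W) (J : Type) (r : seq J) (G : J -> U) :
  linear F -> F (\sum_(i <- r) G i) = \sum_(i <- r) F (G i).
Proof.
move=> linF; pose Fa := GRing.isLinear.Build _ _ _ _ F linF.
pose F' : {linear U -> W} := HB.pack F Fa.
exact: (raddf_sum F').
Qed.

Lemma linear_map0 (U W : lmodType K) (F : U -> W) : linear F -> F 0 = 0.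
Proof. by move=> /(linear_big [::] (fun _ : unit => 0)); rewrite !big_nil. Qed.

Lemma linear_mapD (U W : lmodType K) (F : U -> W) (u v : U) : linear F -> F (u + v) = F u + F v.
Proof. by move=> /(_ 1 u v); rewrite !scale1r. Qed.

Lemma malg_linear_sum (F : {malg K[I]} -> V) x : linear F ->
  F x = \sum_(k <- msupp x) x@_k *: F << k >>.
Proof.
move=> linF; pose Fa := GRing.isLinear.Build _ _ _ _ F linF.
pose F' : {linear {malg K[I]} -> V} := HB.pack F Fa.
rewrite -[F]/(F' : _ -> _) {1}(monalgE x) raddf_sum; apply: eq_bigr => k _.
by rewrite -linearZ; congr (F' _); apply/malgP => l; rewrite mcoeffZ !mcoeffU mulr_natr.
Qed.

Lemma malg_linear_eq (F G : {malg K[I]} -> V) : linear F -> linear G ->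
  (forall k, F << k >> = G << k >>) -> F =1 G.
Proof.
move=> linF linG E x; rewrite (malg_linear_sum x linF) (malg_linear_sum x linG).
by apply: eq_bigr => k _; rewrite E.
Qed.

Definition linear_extension f x : V := \sum_(k <- msupp x) x@_k *: f k.

Lemma linear_extensionEw f x (A : {fset I}) : (msupp x `<=` A)%fset ->
  linear_extension f x = \sum_(k <- A) x@_k *: f k.
Proof.
move=> sA; rewrite /linear_extension (big_fset_incl _ sA) // => k _ /mcoeff_outdom ->.
by rewrite scale0r.
Qed.

Lemma linear_extension_linear f : linear (linear_extension f).
Proof.
move=> a x y; pose A := (msupp x `|` msupp y)%fset.
rewrite !(@linear_extensionEw _ _ A) ?fsubsetUl ?fsubsetUr //; last first.
  by apply: fsubset_trans (msuppD_le _ _) _; apply: fsetSU; apply: msuppZ_le.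
rewrite scaler_sumr -big_split /=; apply: eq_bigr => k _.
by rewrite mcoeffD mcoeffZ scalerDl scalerA.
Qed.

HB.instance Definition _ f :=
  GRing.isLinear.Build K {malg K[I]} V *:%R (linear_extension f) (linear_extension_linear f).

Lemma linear_extensionU f k : linear_extension f << k >> = f k.
Proof. by rewrite /linear_extension msuppU oner_eq0 big_seq_fset1 mcoeffUU scale1r. Qed.

Lemma linear_extension_single f x k :
  (forall l, l != k -> x@_l *: f l = 0) -> linear_extension f x = x@_k *: f k.
Proof.
move=> E; have [kx|kx] := boolP (k \in msupp x).
  rewrite /linear_extension (big_fsetD1 k) //= big1_fset ?addr0 // => l.
  by rewrite !inE => /andP[lk _] _; apply: E.
rewrite mcoeff_outdom // scale0r /linear_extension big1_fset // => l lx _; apply: E.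
by apply: contraNneq kx => <-.
Qed.
End LinearMaps.

Lemma malgU_mul (K : nzRingType) (M : monomType) (k l : M) :
  << k >> * << l >> = << mmul k l >> :> {malg K[M]}.
Proof. by rewrite malgM_def fgmulUU mulr1. Qed.

Section Bilinear.
Variables (K : comNzRingType) (d : nat).
Local Notation H := {malg K[mcomp d]}.
Variable f : mcomp d -> mcomp d -> H.
Local Notation mul := (bilinear_ext f).

Lemma basisE (c : mcomp d) : basis K c = << c >>.
Proof. by rewrite basis.unlock. Qed.

Lemma mcoeff_basis (c e : mcomp d) : (basis K c)@_e = (c == e)%:R.
Proof. by rewrite basisE mcoeffU. Qed.

Lemma linear_extE (g : mcomp d -> H) : linear_ext g = linear_extension g.
Proof. by []. Qed.

Lemma basis_sum (x : H) : x = \sum_(c <- msupp x) x@_c *: basis K c.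
Proof.
have lin_id : linear (@id H) by [].
rewrite {1}(malg_linear_sum x lin_id).
by apply: eq_bigr => c _; rewrite basisE.
Qed.

Lemma bilinear_linearl y : linear (fun x => mul x y).
Proof. exact: linear_extension_linear. Qed.

Lemma bilinear_linearr x : linear (mul x).
Proof.
move=> a y z; rewrite /bilinear_ext /linear_ext scaler_sumr -big_split /=.
apply: eq_bigr => c _; rewrite -!/(linear_ext _ _) linear_extE linearP scalerDr.
by rewrite !scalerA mulrC.
Qed.

Lemma linear_basis_eq (V : lmodType K) (F G : H -> V) : linear F -> linear G ->
  (forall c, F (basis K c) = G (basis K c)) -> F =1 G.
Proof. by move=> lF lG E; apply: malg_linear_eq => // c; rewrite -basisE. Qed.

Lemma linear_comp (U V W : lmodType K) (F : V -> W) (G : U -> V) :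
  linear F -> linear G -> linear (fun x => F (G x)).
Proof. by move=> lF lG a x y; rewrite lG lF. Qed.

Lemma bilinear_commutative : (forall a b, f a b = f b a) -> commutative mul.
Proof.
move=> fC x y.
apply: (linear_basis_eq (F := mul^~ y) (G := mul y)) x.
- exact: bilinear_linearl.
- exact: bilinear_linearr.
move=> c.
apply: (linear_basis_eq (F := mul (basis K c)) (G := mul^~ (basis K c))) y.
- exact: bilinear_linearr.
- exact: bilinear_linearl.
by move=> e; rewrite !bilinear_extU fC.
Qed.

Lemma bilinear_associative :
  (forall a b c, mul (basis K a) (mul (basis K b) (basis K c)) =
                 mul (mul (basis K a) (basis K b)) (basis K c)) -> associative mul.
Proof.
move=> fA x y z; move: x.
apply: (linear_basis_eq (F := fun x => mul x (mul y z)) (G := fun x => mul (mul x y) z)).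
- exact: bilinear_linearl.
- exact: (linear_comp (F := mul^~ z)) (@bilinear_linearl z) (@bilinear_linearl y).
move=> a; move: y.
apply: (linear_basis_eq (F := fun y => mul (basis K a) (mul y z))
                        (G := fun y => mul (mul (basis K a) y) z)).
- exact: linear_comp (@bilinear_linearr _) (@bilinear_linearl _).
- exact: (linear_comp (F := mul^~ z)) (@bilinear_linearl _) (@bilinear_linearr _).
move=> b; move: z.
apply: (linear_basis_eq (F := fun z => mul (basis K a) (mul (basis K b) z))).
- exact: linear_comp (@bilinear_linearr _) (@bilinear_linearr _).
- exact: bilinear_linearr.
exact: fA.
Qed.

Lemma bilinear_left_unit : (forall b, f (empty_comp d) b = basis K b) ->
  left_id (unit_H K d) mul.
Proof.
move=> f1; apply: (linear_basis_eq (F := mul (unit_H K d)) (G := id)) => [|//|c].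
  exact: bilinear_linearr.
by rewrite bilinear_extU f1.
Qed.
End Bilinear.

(** * Sums of compositions bounded by interleavings of blocks *)

Section BasisSums.
Variables (K : comNzRingType) (d : nat).
Local Notation H := {malg K[mcomp d]}.
Implicit Types (a b c : mcomp d) (P : mcomp d -> Prop).

Lemma diag0 a : diag (empty_comp d) a = a.
Proof. by apply: mcomp_ext => //= i j _ _; rewrite entry_diag /= !subn0. Qed.

Lemma blocks_diag a b : blocks (diag a b) = blocks a ++ blocks b.
Proof. by apply: diags_inj; rewrite diags_cat !blocksK. Qed.

Lemma blocks_empty : blocks (empty_comp d) = [::].
Proof. by apply: diags_inj; rewrite blocksK. Qed.

Lemma blocks_nil a : blocks a = [::] -> a = empty_comp d.
Proof. by move=> E; rewrite -[a]blocksK E. Qed.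

(** The filtration by the number of blocks, whose associated graded product is the shuffle of
    words. *)
Definition shuffle_bound a b c :=
  (size (blocks c) < size (blocks a) + size (blocks b))%N \/
  shuf (blocks a) (blocks b) (blocks c).

Lemma shuffle_bound_0l a : shuffle_bound (empty_comp d) a a.
Proof. by right; rewrite blocks_empty; apply: shuf0w. Qed.

Lemma shuffle_bound_0r a : shuffle_bound a (empty_comp d) a.
Proof. by right; rewrite blocks_empty; apply: shuf_sym; apply: shuf0w. Qed.

(** Sums of basis elements rather than arbitrary combinations: with natural coefficients,
    terms never cancel. *)
Definition basis_sum_of (P : mcomp d -> Prop) (x : H) :=
  exists2 s : seq (mcomp d), x = \sum_(c <- s) basis K c & {in s, forall c, P c}.

(** The occurrence of [e] is what makes leading coefficients positive. *)
Definition basis_sum_with (P : mcomp d -> Prop) e (x : H) :=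
  exists s : seq (mcomp d), [/\ x = \sum_(c <- s) basis K c, e \in s & {in s, forall c, P c}].

Lemma basis_sum_of_basis (P : mcomp d -> Prop) c : P c -> basis_sum_of P (basis K c).
Proof.
by move=> Pc; exists [:: c]; rewrite ?big_seq1 // => c'; rewrite inE => /eqP ->.
Qed.

Lemma basis_sum_with_basis (P : mcomp d -> Prop) c : P c -> basis_sum_with P c (basis K c).
Proof.
by move=> Pc; exists [:: c]; split; rewrite ?big_seq1 ?mem_head // => c'; rewrite inE => /eqP ->.
Qed.

Lemma basis_sum_ofD P x y : basis_sum_of P x -> basis_sum_of P y -> basis_sum_of P (x + y).
Proof.
move=> [s -> sP] [t -> tP]; exists (s ++ t); first by rewrite big_cat.
by move=> c; rewrite mem_cat => /orP[/sP|/tP].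
Qed.

Lemma basis_sum_of_sum P (I : Type) (r : seq I) (Q : pred I) (F : I -> H) :
  (forall i, Q i -> basis_sum_of P (F i)) -> basis_sum_of P (\sum_(i <- r | Q i) F i).
Proof.
move=> FP; apply: (big_ind (basis_sum_of P)) => //; last exact: basis_sum_ofD.
by exists [::] => //; rewrite big_nil.
Qed.

Lemma basis_sum_withD P e x y :
  basis_sum_with P e x -> basis_sum_of P y -> basis_sum_with P e (x + y).
Proof.
move=> [s [-> es sP]] [t -> tP]; exists (s ++ t); split; first by rewrite big_cat.
  by rewrite mem_cat es.
by move=> c; rewrite mem_cat => /orP[/sP|/tP].
Qed.

Lemma basis_sum_with_sum P e (I : eqType) (r : seq I) (Q : pred I) (F : I -> H) i0 :
  i0 \in r -> Q i0 -> basis_sum_with P e (F i0) ->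
  (forall i, Q i -> basis_sum_of P (F i)) ->
  basis_sum_with P e (\sum_(i <- r | Q i) F i).
Proof.
move=> i0r Q0 F0 FP; rewrite (big_rem i0) //= Q0.
by apply: basis_sum_withD => //; apply: basis_sum_of_sum.
Qed.

Lemma basis_sum_with_of P e x :
  basis_sum_with P e x -> basis_sum_of P x.
Proof. by case=> s [-> _ sP]; exists s. Qed.

End BasisSums.

(** * Triangularity of the Lyndon monomials *)

Lemma exists_max (T : eqType) (r : rel T) (s : seq T) : total r -> transitive r ->
  s != [::] -> exists2 m, m \in s & {in s, forall x, r m x}.
Proof.
move=> rt rtr; have : sorted r (sort r s) by apply: sort_sorted.
have := permEl (perm_sort r s); case: (sort r s) => [|m t] E ss s0.
  by move: E s0; rewrite perm_sym => /perm_nilP ->.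
have {}E : m :: t =i s by apply: perm_mem.
exists m => [|x]; first by rewrite -E mem_head.
rewrite -E inE => /predU1P[->|]; first by have := rt m m; rewrite orbb.
by move=> xt; move: ss => /= /(order_path_min rtr) /allP; apply.
Qed.

Section Monomials.
Variables (I : choiceType).
Implicit Types (m : {cmonom I}) (s : seq I).

Definition letters m := flatten [seq nseq (m i) i | i <- finsupp m].

Lemma count_letters m i : count_mem i (letters m) = m i.
Proof.
rewrite /letters count_flatten -map_comp sumnE big_map.
under eq_bigr => j _ do rewrite /= count_nseq /=.
have [im|im] := boolP (i \in finsupp m).
  rewrite (big_fsetD1 i) //= eqxx mul1n big1_fset ?addn0 // => j.
  by rewrite !inE => /andP[/negPf ->].
rewrite big1_fset; last by move=> j jm _; case: eqP im => // <-; rewrite jm.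
by move: im; rewrite -cmE_eq0 => /eqP.
Qed.

Lemma monom_of_letters s : exists m, forall i, m i = count_mem i s.
Proof.
elim: s => [|j s [m E]]; first by exists mone => i; rewrite cm1.
by exists (mmul (ucm j) m) => i; rewrite cmM cmU E.
Qed.
End Monomials.

Section Radford.
Variables (K : comAlgType rat) (d : nat) (lt : rel (con_comp d)).
Hypotheses (lt_irr : irreflexive lt) (lt_trans : transitive lt)
    (lt_total : forall a b : con_comp d, a != b -> lt a b || lt b a).
Local Notation H := {malg K[mcomp d]}.
Local Notation L := (lyndon_word lt).
Local Notation B := (@lyndon_basis K d lt).
Local Notation lexlt := (lexlt lt).
Local Notation one := (unit_H K d).
Variable mul : H -> H -> H.
Local Notation bmul a b := (mul (basis K a) (basis K b)).
Hypotheses (mul_linearl : forall y, linear (mul^~ y))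
  (mul_linearr : forall x, linear (mul x)).
Hypotheses (mulC : commutative mul) (mulA : associative mul) (mul1 : left_id one mul).
Hypothesis mul_basis : forall a b,
  basis_sum_with (shuffle_bound a b) (diag a b) (bmul a b).
Implicit Types (s t : seq L) (w : seq (con_comp d)) (m : {cmonom L}).

Definition lyndon_product s : H := foldr (fun i x => mul (B i) x) one s.

Lemma lyndon_product_cat s t : lyndon_product (s ++ t) = mul (lyndon_product s) (lyndon_product t).
Proof. by elim: s => [|i s IH] /=; rewrite ?mul1 // IH mulA. Qed.

Lemma lyndon_product_perm s t : perm_eq s t -> lyndon_product s = lyndon_product t.
Proof.
elim: s t => [|i s IH] t; first by rewrite perm_sym => /perm_nilP ->.
move=> st; have it : i \in t by rewrite -(perm_mem st) mem_head.
case/splitPr: it st => t1 t2; rewrite perm_sym -cat1s perm_catCA /= perm_cons perm_sym.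
move/IH => /= ->; rewrite !lyndon_product_cat /= !mulA; congr (mul _ _); exact: mulC.
Qed.

Definition lyndon_ge (i j : L) := lexge lt (val i) (val j).

Lemma lyndon_ge_total : total lyndon_ge. Proof. by move=> i j; apply: lexge_total. Qed.
Lemma lyndon_ge_trans : transitive lyndon_ge. Proof. by move=> i j k; apply: lexge_trans. Qed.
Lemma lyndon_ge_anti : antisymmetric lyndon_ge.
Proof. by move=> i j /(lexge_anti lt_irr lt_total)/val_inj. Qed.

Definition lyndon_letters m := sort lyndon_ge (letters m).

Lemma count_lyndon_letters m i : count_mem i (lyndon_letters m) = m i.
Proof. by rewrite -(count_letters m i); exact: (seq.permP (permEl (perm_sort lyndon_ge _))). Qed.

Lemma lyndon_letters_sorted m : sorted lyndon_ge (lyndon_letters m).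
Proof. exact: sort_sorted lyndon_ge_total _. Qed.

Lemma lyndon_letters_eq m s :
  sorted lyndon_ge s -> (forall i, m i = count_mem i s) -> lyndon_letters m = s.
Proof.
move=> ss E; apply: (sorted_eq lyndon_ge_trans lyndon_ge_anti) => //.
  exact: lyndon_letters_sorted.
by apply/allP => i _ /=; rewrite count_lyndon_letters E.
Qed.

Lemma lyndon_product_lettersM m1 m2 :
  lyndon_product (lyndon_letters (mmul m1 m2)) =
  mul (lyndon_product (lyndon_letters m1)) (lyndon_product (lyndon_letters m2)).
Proof.
rewrite -lyndon_product_cat; apply: lyndon_product_perm; apply/allP => i _ /=.
by rewrite count_cat !count_lyndon_letters cmM.
Qed.

Definition word m := flatten (map val (lyndon_letters m)).

Lemma lyndon_letters_decreasing m : decreasing lt (map val (lyndon_letters m)).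
Proof.
rewrite /decreasing sorted_map lyndon_letters_sorted /=.
by apply/allP => _ /mapP[i _ ->]; apply: valP.
Qed.

Lemma word_inj : injective word.
Proof.
move=> m1 m2 /(decreasing_flatten_inj lt_irr lt_trans lt_total).
rewrite !lyndon_letters_decreasing => /(_ isT isT) /(inj_map val_inj) E.
by apply/eqP/cmP => i; rewrite -!count_lyndon_letters E.
Qed.

Lemma word_surj w : exists m, word m = w.
Proof.
have [s /andP[ss Ls] <-] := lyndon_factorization lt_irr lt_trans w.
have [t Et] : exists t : seq L, map val t = s.
  elim: s Ls {ss} => [|l s IH] /=; first by exists [::].
  by case/andP=> Ll /IH[t <-]; exists (Sub l Ll :: t).
have [m Em] := monom_of_letters t; exists m.
rewrite /word (lyndon_letters_eq (s := t)) ?Et //.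
by move: ss; rewrite -Et sorted_map.
Qed.

(** The words to be found in the support of a Lyndon monomial with leading word [w]. *)
Definition below w (c : mcomp d) :=
  (size (blocks c) < size w)%N || perm_eq (blocks c) w && lexlt (blocks c) w.

(** Multiplying by a Lyndon word [l] that is at least the first factor of [w] turns the leading
    word [w] into [l ++ w], and the terms below [w] contribute only terms below [l ++ w]. *)
Lemma shuf_below (l : seq (con_comp d)) (s : seq (seq (con_comp d))) c e :
  decreasing lt (l :: s) -> let w := flatten s in
  c = diags w \/ below w c ->
  (size (blocks e) < size l + size (blocks c))%N \/ shuf l (blocks c) (blocks e) ->
  (e = diags (l ++ w) /\ c = diags w) \/ e != diags (l ++ w) /\ below (l ++ w) e.
Proof.
move=> dls w hc he.
have below_ne : below (l ++ w) e -> e != diags (l ++ w) /\ below (l ++ w) e.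
  move=> be; split=> //; apply: contraTneq be => ->.
  by rewrite /below diagsK ltnn (lexlt_irr lt_irr) andbF.
have le_size : (size (blocks c) <= size w)%N.
  by case: hc => [->|/orP[/ltnW//|/andP[/perm_size -> //]]]; rewrite diagsK.
case: he => [lt_e|he].
  right; apply: below_ne; rewrite /below size_cat (leq_trans lt_e) //.
  by rewrite leq_add2l.
case: hc => [Ec|].
  move: he; rewrite Ec diagsK => he.
  have := shuf_lyndon_le lt_irr lt_trans lt_total dls he.
  case/(lexge_eqVlt lt_irr lt_total) => [Ee|le].
    by left; rewrite Ee blocksK.
  by right; apply: below_ne; rewrite /below le (shuf_perm he) orbT.
case/orP=> [lt_c|/andP[pc lc]].
  right; apply: below_ne; rewrite /below (shuf_size he) size_cat.
  by rewrite ltn_add2l lt_c.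
right; apply: below_ne; apply/orP; right; apply/andP; split.
  by apply: perm_trans (shuf_perm he) _; rewrite perm_cat2l.
have [w' he' lt_e] := shuf_lexlt he (perm_size pc) lc.
have := shuf_lyndon_le lt_irr lt_trans lt_total dls he'.
exact: lexlt_ge_trans lt_irr lt_trans lt_total _ _ _ lt_e.
Qed.

Lemma mcoeff_bmul a b : exists s : seq (mcomp d),
  [/\ forall e, (bmul a b)@_e = (count_mem e s)%:R, diag a b \in s
    & {in s, forall c, shuffle_bound a b c}].
Proof.
have [s [-> sd sP]] := mul_basis a b; exists s; split=> // e.
rewrite raddf_sum /= -sum1_count natr_sum /= [RHS]big_mkcond /=.
by apply: eq_bigr => c _; rewrite mcoeff_basis; case: (c == e).
Qed.

(** The leading coefficient counts the ways to interleave the factors that give back their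
    concatenation: a positive integer. *)
Lemma lyndon_product_leading s : decreasing lt (map val s) -> let w := flatten (map val s) in
  (exists n, (lyndon_product s)@_(diags w) = n.+1%:R) /\
  (forall c, c != diags w -> (lyndon_product s)@_c != 0 -> below w c).
Proof.
elim: s => [_|i s IH] /=.
  split; first by exists 0%N; rewrite /unit_H mcoeff_basis eqxx.
  by move=> c; rewrite /unit_H mcoeff_basis; have [<-|_] := eqVneq (empty_comp d) c; rewrite ?eqxx.
move=> dls; set l := val i; set w := flatten (map val s).
have [_ ds _] := decreasing_head lt_irr lt_trans lt_total dls.
have [[n En] IHb] := IH ds; rewrite -/w in En IHb.
have E e : (mul (B i) (lyndon_product s))@_e = \sum_(c <- msupp (lyndon_product s))
    (lyndon_product s)@_c * (bmul (diags l) c)@_e.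
  rewrite (malg_linear_sum _ (@mul_linearr (B i))) raddf_sum /=.
  by apply: eq_bigr => c _; rewrite mcoeffZ -basisE.
have hc c : (lyndon_product s)@_c != 0 -> c = diags w \/ below w c.
  by have [->|cw] := eqVneq c (diags w); [left | right; apply: IHb].
have key c e : (lyndon_product s)@_c != 0 -> (bmul (diags l) c)@_e != 0 ->
  (e = diags (l ++ w) /\ c = diags w) \/ e != diags (l ++ w) /\ below (l ++ w) e.
  have [t [Et _ tP]] := mcoeff_bmul (diags l) c.
  rewrite Et => /hc c0 e0; have et : e \in t.
    by apply: contraNT e0 => /count_memPn ->.
  by apply: shuf_below c0 _ => //; have := tP e et; rewrite /shuffle_bound diagsK.
split.
  have [t [Et dt _]] := mcoeff_bmul (diags l) (diags w).
  exists (n.+1 * count_mem (diags (l ++ w)) t).-1%N.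
  rewrite prednK; last by rewrite muln_gt0 /= -has_count has_pred1 diags_cat.
  rewrite E natrM -En -Et.
  have := @linear_extension_single K _ K^o
    (fun c => (bmul (diags l) c)@_(diags (l ++ w))) (lyndon_product s) (diags w).
  apply=> c cw; apply/eqP; apply: contraT => ne0.
  have c0 : (lyndon_product s)@_c != 0 by apply: contraNneq ne0 => ->; rewrite scale0r.
  have e0 : (bmul (diags l) c)@_(diags (l ++ w)) != 0.
    by apply: contraNneq ne0 => ->; rewrite scaler0.
  case: (key _ _ c0 e0) => [[_ /eqP]|[/eqP//]]; by rewrite (negPf cw).
move=> e ew; rewrite E => ne0.
have [c c0 e0] : exists2 c, (lyndon_product s)@_c != 0 & (bmul (diags l) c)@_e != 0.
  apply: contrapT => hn; move/negP: ne0; apply; rewrite big1 // => c _.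
  apply/eqP; apply: contraT => ne0; case: hn; exists c.
    by apply: contraNneq ne0 => ->; rewrite mul0r.
  by apply: contraNneq ne0 => ->; rewrite mulr0.
by case: (key _ _ c0 e0) => [[/eqP]|[]//]; rewrite (negPf ew).
Qed.

Definition radford_map : {malg K[{cmonom L}]} -> H :=
  linear_extension (fun m => lyndon_product (lyndon_letters m)).
HB.instance Definition _ := GRing.Linear.on radford_map.

Lemma radford_mapU m : radford_map << m >> = lyndon_product (lyndon_letters m).
Proof. exact: linear_extensionU. Qed.

(** Makes the leading coefficients of the Lyndon monomials invertible. *)
Lemma inv_natK n : (n.+1%:R^-1 : rat)%:A * n.+1%:R = 1 :> K.
Proof.
have -> : n.+1%:R = (n.+1%:R : rat)%:A :> K by rewrite scaler_nat.
by rewrite -scalerAl mul1r scalerA mulVf ?scale1r // Num.Theory.pnatr_eq0.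
Qed.

(** In a nonzero element of the kernel, a monomial whose word is largest, by length and then
    lexicographically, would contribute the only term of the image at that word. *)
Lemma radford_inj : injective radford_map.
Proof.
move=> x y /eqP; rewrite -subr_eq0 -linearB /= => /eqP z0; apply/eqP.
rewrite -subr_eq0; apply: contraT; move: (x - y) z0 => z z0 nz {x y}.
pose r (m m' : {cmonom L}) := (size (word m') < size (word m))%N ||
   (size (word m') == size (word m)) && lexge lt (word m) (word m').
have r_total : total r.
  move=> m m'; rewrite /r; case: ltngtP => //= _; exact: lexge_total.
have r_trans : transitive r.
  move=> m2 m1 m3; rewrite /r.
  case/orP=> [h1|/andP[/eqP <- h1]]; case/orP=> [h2|/andP[/eqP -> h2]].
  - by rewrite (ltn_trans h2 h1).
  - by rewrite h1.
  - by rewrite h2.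
  - by rewrite eqxx (lexge_trans lt_irr lt_trans lt_total h1 h2) orbT.
have [|m mz mmax] := exists_max (s := msupp z) r_total r_trans.
  apply: contraNneq nz => s0; rewrite (monalgE z).
  by rewrite s0 big_nil.
have [[n En] _] := lyndon_product_leading (lyndon_letters_decreasing m).
move: (congr1 (mcoeff (diags (word m))) z0); rewrite mcoeff0.
rewrite /radford_map /linear_extension raddf_sum /=.
have := @linear_extension_single K _ K^o
  (fun c => (lyndon_product (lyndon_letters c))@_(diags (word m))) z m.
rewrite {1}/linear_extension => Es; under eq_bigr => c _ do rewrite mcoeffZ.
rewrite {}Es; last first.
  move=> m' mm'; have [m'z|] := boolP (m' \in msupp z); last first.
    by move/mcoeff_outdom => ->; rewrite scale0r.
  apply/eqP; apply: contraT => ne0.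
  have e0 : (lyndon_product (lyndon_letters m'))@_(diags (word m)) != 0.
    by apply: contraNneq ne0 => ->; rewrite scaler0.
  have [_ /(_ (diags (word m)))] := lyndon_product_leading (lyndon_letters_decreasing m').
  rewrite (inj_eq (@diags_inj _)) (inj_eq word_inj) eq_sym mm' => /(_ isT e0).
  rewrite /below diagsK -/(word m').
  have := mmax _ m'z; rewrite /r; case: ltngtP => //= [ls _ /andP[/perm_size Es]|].
    by rewrite Es ltnn in ls.
  by move=> _ + /andP[_]; rewrite /lexge => /negPf ->.
rewrite En; move: mz; rewrite -mcoeff_neq0 => mz /eqP.
rewrite -[_ *: _]/(_ * _) => /eqP E; case/negP: mz; apply/eqP.
by rewrite -[LHS]mulr1 -(inv_natK n) mulrCA E mulr0.
Qed.

(** The order on letters need not be well founded, but the words below [w] that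
    have its length are permutations of [w], hence finite in number. *)
Lemma below_ind (P : seq (con_comp d) -> Prop) :
  (forall w, (forall c, below w c -> P (blocks c)) -> P w) -> forall w, P w.
Proof.
move=> step w; pose lower v := [seq u <- permutations v | lexlt u v].
have lower_lt u v : perm_eq u v -> lexlt u v -> (size (lower u) < size (lower v))%N.
  move=> puv luv; rewrite -[(size _).+1]/(size (u :: lower u)); apply: uniq_leq_size.
    by rewrite /= filter_uniq ?permutations_uniq // andbT mem_filter (lexlt_irr lt_irr).
  move=> x; rewrite inE !mem_filter !mem_permutations => /predU1P[->|/andP[xu pxu]].
    by rewrite luv puv.
  by rewrite (lexlt_trans lt_trans xu luv) // (perm_trans pxu puv).
move: {2}(size w) (leqnn (size w)) => N; elim: N w => [|N IHN] w.
  rewrite leqn0 size_eq0 => /eqP ->; apply: step => c; rewrite /below /=.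
  by case/andP=> /perm_nilP ->.
move: {2}(size (lower w)) (leqnn (size (lower w))) => M.
elim: M w => [|M IHM] w lw sw; apply: step => c /orP[sc|/andP[pc lc]].
- by apply: IHN; rewrite -ltnS (leq_trans sc).
- by have := leq_trans (lower_lt _ _ pc lc) lw.
- by apply: IHN; rewrite -ltnS (leq_trans sc).
apply: IHM; last by rewrite (perm_size pc).
by rewrite -ltnS (leq_trans (lower_lt _ _ pc lc)).
Qed.

(** Subtract from the Lyndon monomial with leading word [w] its lower terms. *)
Lemma basis_in_image w : exists x, radford_map x = basis K (diags w).
Proof.
elim/below_ind: w => w IH.
have [m Em] := word_surj w.
have [[n En] bel] := lyndon_product_leading (lyndon_letters_decreasing m).
rewrite -/(word m) Em in En bel.
set T := lyndon_product (lyndon_letters m) in En bel.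
have [y Ey] : exists y, radford_map y = T - n.+1%:R *: basis K (diags w).
  set T' := T - _; rewrite (basis_sum T') big_seq.
  apply: (big_ind (fun z => exists y, radford_map y = z)).
  - by exists 0; rewrite linear0.
  - by move=> _ _ [y1 <-] [y2 <-]; exists (y1 + y2); rewrite linearD.
  move=> c cT; rewrite -mcoeff_neq0 mcoeffB mcoeffZ mcoeff_basis in cT.
  have cw : c != diags w by apply: contraNneq cT => ->; rewrite eqxx mulr1 En subrr.
  rewrite [diags w == c]eq_sym (negPf cw) mulr0 subr0 in cT.
  have [y Ey] := IH _ (bel _ cw cT); move: (T'@_c) => a.
  by rewrite blocksK in Ey; exists (a *: y); rewrite linearZ /= Ey.
exists ((n.+1%:R^-1 : rat)%:A *: (<< m >> - y)).
rewrite linearZ linearB /= Ey radford_mapU -/T subKr scalerA.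
by rewrite inv_natK scale1r.
Qed.

Lemma radford_surj x : exists y, radford_map y = x.
Proof.
rewrite (basis_sum x); apply: (big_ind (fun z => exists y, radford_map y = z)).
- by exists 0; rewrite linear0.
- by move=> _ _ [y1 <-] [y2 <-]; exists (y1 + y2); rewrite linearD.
move=> c _; have [y] := basis_in_image (blocks c); rewrite blocksK => Ey.
move: (x@_c) => a; exists (a *: y).
by rewrite linearZ /= Ey.
Qed.

(** Sending a monomial to the product of its Lyndon words is multiplicative, as the product is
    commutative and associative, and bijective by triangularity. *)
Theorem lyndon_freely_generates : freely_generates mul one B.
Proof.
exists radford_map; split.
- by rewrite /= -[1]/<< mone >> radford_mapU (@lyndon_letters_eq _ [::]) // => i; rewrite cm1.
- move=> x y /=; move: x.
  apply: (malg_linear_eq (F := fun x => radford_map (x * y))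
                         (G := fun x => mul (radford_map x) (radford_map y))).
  + by move=> a x z; rewrite mulrDl -scalerAl linearP.
  + exact: (linear_comp (F := mul^~ (radford_map y)) (@mul_linearl _)
      (@linearP _ _ _ _ radford_map)).
  move=> m; move: y.
  apply: (malg_linear_eq (F := fun y => radford_map (<< m >> * y))
                         (G := fun y => mul (radford_map << m >>) (radford_map y))).
  + by move=> a x z; rewrite mulrDr -scalerAr linearP.
  + exact: (linear_comp (@mul_linearr _) (@linearP _ _ _ _ radford_map)).
  move=> m'; rewrite malgU_mul; apply: etrans (radford_mapU _) _.
  rewrite lyndon_product_lettersM; congr (mul _ _); exact/esym/radford_mapU.
- move=> i /=; rewrite radford_mapU (@lyndon_letters_eq _ [:: i]) //=.
    by rewrite mulC mul1.
  by move=> j; rewrite cmU addn0.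
have ex x : exists y, radford_map y == x.
  by have [y <-] := radford_surj x; exists y.
have exK x : radford_map (xchoose (ex x)) = x by apply/eqP: (xchooseP (ex x)).
by exists (fun x => xchoose (ex x)) => x //; apply: radford_inj; rewrite exK.
Qed.
End Radford.

(** * Increasing maps between intervals *)

Section Increasing.
Implicit Types (m n s j N : nat).

Definition increasing m N (f : 'I_m -> 'I_N) : bool :=
  [forall i : 'I_m, forall i' : 'I_m, (i < i')%N ==> (f i < f i')%N].

Lemma increasingP m N (f : 'I_m -> 'I_N) :
  reflect (forall i i' : 'I_m, (i < i')%N -> (f i < f i')%N) (increasing f).
Proof.
apply: (iffP forallP) => [H i i' ii'|H i].
  by have /forallP/(_ i')/implyP := H i; apply.
by apply/forallP => i'; apply/implyP; apply: H.
Qed.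

Lemma increasing_inj m N (f : 'I_m -> 'I_N) : increasing f -> injective f.
Proof.
move=> /increasingP H i i' E; apply: val_inj.
by case: (ltngtP i i') => // /H; rewrite E ltnn.
Qed.

Lemma increasing_on_blocksE m s N (F : 'I_(m + s) -> 'I_N) :
  increasing_on_blocks F =
  increasing (fun i => F (lshift s i)) && increasing (fun i => F (rshift m i)).
Proof. by []. Qed.

Let ltord N : rel 'I_N := fun x y => (x < y)%N.

Lemma ltord_sorted_eq N (s t : seq 'I_N) :
  sorted (@ltord N) s -> sorted (@ltord N) t -> s =i t -> s = t.
Proof.
apply: irr_sorted_eq => [y x z|x]; rewrite /ltord ?ltnn //; exact: ltn_trans.
Qed.

Lemma sorted_enum_ord N (A : {pred 'I_N}) : sorted (@ltord N) (enum A).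
Proof.
rewrite -(eq_sorted (e := relpre val ltn)) // -sorted_map.
apply: (subseq_sorted ltn_trans (s2 := map val (enum 'I_N))).
  by rewrite enumT; apply: map_subseq; apply: filter_subseq.
by rewrite val_enum_ord iota_ltn_sorted.
Qed.

Lemma increasing_sorted m N (f : 'I_m -> 'I_N) : increasing f ->
  sorted (@ltord N) [seq f i | i <- enum 'I_m].
Proof.
move=> /increasingP H; rewrite sorted_map.
by apply: sub_sorted (sorted_enum_ord _) => i i'; apply: H.
Qed.

(** An increasing map lists its image in order. *)
Lemma increasing_enum_eq m n N (f : 'I_m -> 'I_N) (g : 'I_n -> 'I_N) :
  increasing f -> increasing g -> (forall x, (exists i, f i = x) <-> (exists i, g i = x)) ->
  [seq f i | i <- enum 'I_m] = [seq g i | i <- enum 'I_n].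
Proof.
move=> /increasing_sorted sf /increasing_sorted sg E; apply: ltord_sorted_eq => // x.
apply/mapP/mapP => -[i _ ->].
  by have [j <-] := (E (f i)).1 (ex_intro _ i erefl); exists j; rewrite ?mem_enum.
by have [j <-] := (E (g i)).2 (ex_intro _ i erefl); exists j; rewrite ?mem_enum.
Qed.

Lemma increasing_eq m N (f g : {ffun 'I_m -> 'I_N}) : increasing f -> increasing g ->
  (forall x, (exists i, f i = x) <-> (exists i, g i = x)) -> f = g.
Proof.
move=> If Ig E; apply/ffunP => i.
have /eq_in_map/(_ i) := increasing_enum_eq If Ig E.
by apply; rewrite mem_enum.
Qed.

Lemma enum_val_increasing N (A : {set 'I_N}) : increasing (@enum_val _ (mem A)).
Proof.
apply/increasingP => i i' ii'; have x0 := enum_val i.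
rewrite (enum_val_nth x0 i) (enum_val_nth x0 i').
have ltr : transitive (@ltord N) by move=> y x z; apply: ltn_trans.
apply: (sorted_ltn_nth ltr x0 (sorted_enum_ord (mem A))) => //;
  by rewrite inE -cardE ltn_ord.
Qed.

Definition compose_qsh m s j N (p : qsh m s j) (f : {ffun 'I_j -> 'I_N}) :
  {ffun 'I_(m + s) -> 'I_N} := [ffun u => f (val p u)].

Lemma compose_qsh_image m s j N (p : qsh m s j) (f : {ffun 'I_j -> 'I_N}) x :
  (exists u, compose_qsh p f u = x) <-> (exists i, f i = x).
Proof.
split=> [[u]|[i <-]]; first by rewrite ffunE; exists (val p u).
have /forallP/(_ i)/existsP[u /eqP <-] := qsh_surj p.
by exists u; rewrite ffunE.
Qed.

(** A map increasing on both blocks, with an image of size [j], factors uniquely as a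
    quasi-shuffle onto ['I_j] followed by the increasing enumeration of its image. *)
Lemma sum_compose_qsh (V : nmodType) m s j N (G : {ffun 'I_(m + s) -> 'I_N} -> V) :
  \sum_(p : qsh m s j) \sum_(f : {ffun 'I_j -> 'I_N} | increasing f) G (compose_qsh p f) =
  \sum_(F : {ffun 'I_(m + s) -> 'I_N} |
    increasing_on_blocks F && (#|[set F u | u in 'I_(m + s)]| == j)) G F.
Proof.
rewrite pair_big_dep /=.
pose h (pf : qsh m s j * {ffun 'I_j -> 'I_N}) := compose_qsh pf.1 pf.2.
pose A := [set pf : qsh m s j * {ffun 'I_j -> 'I_N} | increasing pf.2].
transitivity (\sum_(F in h @: A) G F); last first.
  apply: eq_bigl => F; apply/imsetP/andP => [[[p f]]|[iF /eqP Ej]].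
    rewrite inE /= => incf ->; split.
      have /andP[_ /andP[/increasingP p1 /increasingP p2]] := valP p.
      move/increasingP: incf => incf; apply/andP; split; apply/increasingP => i i' ii';
        rewrite !ffunE; apply: incf; [exact: p1 | exact: p2].
    have -> : [set h (p, f) u | u in 'I_(m + s)] = [set f i | i in 'I_j].
      apply/setP => x; apply/imsetP/imsetP => -[u _ ->].
        by have [i <-] := (compose_qsh_image p f _).1 (ex_intro _ u erefl); exists i.
      by have [i <-] := (compose_qsh_image p f _).2 (ex_intro _ u erefl); exists i.
    by rewrite card_imset ?card_ord //; apply: increasing_inj.
  subst j; set S := [set F u | u in 'I_(m + s)].
  have FS u : F u \in S by apply: imset_f.
  pose f : {ffun 'I_#|S| -> 'I_N} := [ffun i => enum_val i].
  pose p : {ffun 'I_(m + s) -> 'I_#|S|} := [ffun u => enum_rank_in (FS u) (F u)].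
  have fp u : f (p u) = F u by rewrite !ffunE enum_rankK_in.
  have incf : increasing f.
    by apply/increasingP => i i' ii'; rewrite !ffunE;
      move/increasingP: (enum_val_increasing S); apply.
  have incfE (x y : 'I_#|S|) : (f x < f y)%N -> (x < y)%N.
    case: (ltngtP x y) => // [yx|/val_inj ->]; last by rewrite ltnn.
    by move/increasingP: incf => /(_ _ _ yx) fyx /(ltn_trans fyx); rewrite ltnn.
  have pP : surjectiveb p && increasing_on_blocks p.
    apply/andP; split.
      apply/forallP => x; apply/existsP.
      have /imsetP[u _ Eu] := enum_valP x; exists u; apply/eqP.
      by apply: (increasing_inj incf); rewrite fp -Eu ffunE.
    by move: iF => /andP[/increasingP F1 /increasingP F2]; apply/andP; split;
      apply/increasingP => i i' ii'; apply: incfE; rewrite !fp; [apply: F1 | apply: F2].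
  exists (Sub p pP, f); first by rewrite inE.
  by apply/ffunP => u; rewrite ffunE /= fp.
rewrite big_imset /=.
  by apply: eq_bigl => -[p f]; rewrite inE.
move=> [p1 f1] [p2 f2]; rewrite !inE /= => i1 i2 E.
have Ef : f1 = f2.
  apply: increasing_eq => // x.
  by rewrite -(compose_qsh_image p1) -(compose_qsh_image p2); rewrite /h /= in E; rewrite E.
subst f2; congr (_, _); apply: val_inj; apply/ffunP => u.
apply: (increasing_inj i1); have /ffunP/(_ u) := E.
by rewrite !ffunE.
Qed.

Lemma sum_increasing_on_blocks (V : nmodType) m s N
    (G : {ffun 'I_(m + s) -> 'I_N} -> V) : (0 < m)%N ->
  \sum_(F : {ffun 'I_(m + s) -> 'I_N} | increasing_on_blocks F) G F =
  \sum_(1 <= j < (m + s).+1) \sum_(p : qsh m s j)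
    \sum_(f : {ffun 'I_j -> 'I_N} | increasing f) G (compose_qsh p f).
Proof.
move=> m0; under [RHS]eq_bigr => j _ do rewrite sum_compose_qsh big_mkcondr.
rewrite exchange_big /=; apply: eq_bigr => F _; rewrite -big_mkcond /=.
under eq_bigl => j do rewrite eq_sym.
rewrite big_nat1_eq; case: ifPn => // /negP[].
have le_ms : (#|[set F u | u : 'I_(m + s)]| <= m + s)%N.
  by apply: leq_trans (leq_imset_card _ _) _; rewrite card_ord.
rewrite ltnS le_ms andbT card_gt0.
apply/set0Pn; exists (F (lshift s (Ordinal m0))); exact: imset_f.
Qed.

Lemma sum_increasing_pair (V : nmodType) m s N
    (G : {ffun 'I_m -> 'I_N} -> {ffun 'I_s -> 'I_N} -> V) :
  \sum_(f : {ffun 'I_m -> 'I_N} | increasing f)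
    \sum_(g : {ffun 'I_s -> 'I_N} | increasing g) G f g =
  \sum_(F : {ffun 'I_(m + s) -> 'I_N} | increasing_on_blocks F)
    G [ffun i => F (lshift s i)] [ffun i => F (rshift m i)].
Proof.
rewrite pair_big /=.
pose h (F : {ffun 'I_(m + s) -> 'I_N}) :
    {ffun 'I_m -> 'I_N} * {ffun 'I_s -> 'I_N} :=
  ([ffun i => F (lshift s i)], [ffun i => F (rshift m i)]).
pose h' (fg : {ffun 'I_m -> 'I_N} * {ffun 'I_s -> 'I_N}) : {ffun 'I_(m + s) -> 'I_N} :=
  [ffun k : 'I_(m + s) => match split k with inl i => fg.1 i | inr i => fg.2 i end].
have hK : cancel h h'.
  by move=> F; apply/ffunP => k; rewrite ffunE; case: split_ordP => i ->; rewrite ffunE.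
have h'K : cancel h' h.
  move=> [f g]; congr (_, _); apply/ffunP => i; rewrite !ffunE.
    by rewrite (unsplitK (inl _ i)).
  by rewrite (unsplitK (inr _ i)).
rewrite (reindex h) /=; last by exists h' => x _.
apply: eq_bigl => F; rewrite increasing_on_blocksE.
by congr (_ && _); apply: eq_forallb => i; apply: eq_forallb => i'; rewrite !ffunE.
Qed.
End Increasing.

(** * Placements of compositions in square matrices *)

(** The synonym carries the entrywise product, a free commutative monoid, so that
    [{malg K[pattern d N]}] is a commutative ring. *)
Definition pattern d N := 'M[{cmonom 'I_d}]_N.
HB.instance Definition _ d N := Choice.copy (pattern d N) 'M[{cmonom 'I_d}]_N.

Section Pattern.
Variables d N : nat.
Implicit Types A B : pattern d N.

Definition pattern1 : pattern d N := \matrix_(i, j) mone.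
Definition pattern_mul A B : pattern d N := \matrix_(i, j) mmul (A i j) (B i j).

Lemma pattern_mulA : associative pattern_mul.
Proof. by move=> A B C; apply/matrixP => i j; rewrite !mxE mulmA. Qed.
Lemma pattern_mulC : commutative pattern_mul.
Proof. by move=> A B; apply/matrixP => i j; rewrite !mxE mulmC. Qed.
Lemma pattern_mul1 : left_id pattern1 pattern_mul.
Proof. by move=> A; apply/matrixP => i j; rewrite !mxE mul1m. Qed.
Lemma pattern_mulr1 : right_id pattern1 pattern_mul.
Proof. by move=> A; rewrite pattern_mulC pattern_mul1. Qed.
Lemma pattern_unit A B : pattern_mul A B = pattern1 -> A = pattern1 /\ B = pattern1.
Proof.
move=> /matrixP E; split; apply/matrixP => i j; have := E i j; rewrite !mxE;
  by case/(@unitm {cmonom 'I_d}).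
Qed.

HB.instance Definition _ := Choice_isMonomialDef.Build (pattern d N)
  pattern_mulA pattern_mul1 pattern_mulr1 pattern_unit.
HB.instance Definition _ := MonomialDef_isConomialDef.Build (pattern d N) pattern_mulC.

Lemma pattern_mulE A B i j : (mmul A B : pattern d N) i j = mmul (A i j) (B i j).
Proof. by rewrite mxE. Qed.
End Pattern.

Section Placement.
Variables d : nat.
Local Notation M := {cmonom 'I_d}.

(** Pushing a matrix forward along arbitrary maps of rows and columns also describes
    placements in a larger matrix; for a block diagonal matrix the placements of the two
    blocks get multiplied entrywise. *)
Lemma quasi_shuffle_mx_diag m n s t j k (A : 'M[M]_(m, n)) (B : 'M[M]_(s, t))
    (F : 'I_(m + s) -> 'I_j) (G : 'I_(n + t) -> 'I_k) x y :
  quasi_shuffle_mx (diag_block A B) F G x y =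
  mmul (quasi_shuffle_mx A (fun i => F (lshift s i)) (fun i => G (lshift t i)) x y)
       (quasi_shuffle_mx B (fun i => F (rshift m i)) (fun i => G (rshift n i)) x y).
Proof.
rewrite !mxE big_split_ord /=; congr (mmul _ _); apply: eq_bigr => u _;
  rewrite big_split_ord /=.
- rewrite [X in mmul _ X]big1 ?mulm1 => [|v _]; last by rewrite /diag_block block_mxEur mxE.
  by apply: eq_bigr => v _; rewrite /diag_block block_mxEul.
- rewrite [X in mmul X _]big1 ?mul1m => [|v _]; last by rewrite /diag_block block_mxEdl mxE.
  by apply: eq_bigr => v _; rewrite /diag_block block_mxEdr.
Qed.

Lemma quasi_shuffle_mx_comp m n j k N (D : 'M[M]_(m, n)) (p : 'I_m -> 'I_j)
    (q : 'I_n -> 'I_k) (f : 'I_j -> 'I_N) (g : 'I_k -> 'I_N) :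
  quasi_shuffle_mx (quasi_shuffle_mx D p q) f g =
  quasi_shuffle_mx D (fun u => f (p u)) (fun v => g (q v)).
Proof.
apply/matrixP => x y; rewrite !mxE.
rewrite [RHS](partition_big p (fun i => f i == x)) //=; apply: eq_bigr => i /eqP fi.
under eq_bigr => l _ do rewrite mxE.
rewrite exchange_big /=.
under [RHS]eq_bigl => u.
  have -> : (f (p u) == x) && (p u == i) = (p u == i).
    by case: (eqVneq (p u) i) => [->|]; rewrite ?andbF // fi eqxx.
  over.
apply: eq_bigr => u _.
rewrite [RHS](partition_big q (fun l => g l == y)) //=; apply: eq_bigr => l /eqP gl.
apply: eq_bigl => v; case: (eqVneq (q v) l) => [->|]; by rewrite ?andbF // gl eqxx.
Qed.

Lemma quasi_shuffle_mxE m n j k (D : 'M[M]_(m, n)) (p : 'I_m -> 'I_j)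
    (q : 'I_n -> 'I_k) u v : injective p -> injective q ->
  quasi_shuffle_mx D p q (p u) (q v) = D u v.
Proof.
move=> ip iq; rewrite mxE (big_pred1 u) => [|i]; last by rewrite /= (inj_eq ip).
by rewrite (big_pred1 v) => // i; rewrite /= (inj_eq iq).
Qed.

Lemma quasi_shuffle_mx_row m n j k (D : 'M[M]_(m, n)) (p : 'I_m -> 'I_j)
    (q : 'I_n -> 'I_k) x y : quasi_shuffle_mx D p q x y != mone ->
  (exists u, p u = x) /\ (exists v, q v = y).
Proof.
rewrite mxE => h; split.
  apply: contrapT => nx; move/negP: h; apply; apply/eqP/big1 => u /eqP pu.
  by case: nx; exists u.
apply: contrapT => ny; move/negP: h; apply; apply/eqP/big1 => u _; apply: big1 => v /eqP qv.
by case: ny; exists v.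
Qed.

(** As no line of a composition is trivial, the lines it occupies in a placement can be read off
    from the entries. *)
Lemma quasi_shuffle_mx_image (a : mcomp d) j k (f : 'I_(nrows a) -> 'I_j)
    (g : 'I_(ncols a) -> 'I_k) : injective f -> injective g ->
  (forall x, (exists u, f u = x) <-> (exists y, quasi_shuffle_mx (mx a) f g x y != mone)) /\
  (forall y, (exists v, g v = y) <-> (exists x, quasi_shuffle_mx (mx a) f g x y != mone)).
Proof.
move=> If Ig; have [ra ca] := no_trivial_lineP _ (mxP a).
split=> z; split=> [[u <-]|[y /quasi_shuffle_mx_row[] //]].
  by have [v h] := ra u; exists (g v); rewrite quasi_shuffle_mxE.
by have [v h] := ca u; exists (f v); rewrite quasi_shuffle_mxE.
Qed.

(** Deleting the trivial lines of a placement recovers the composition. *)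
Lemma placement_inj_size (a b : mcomp d) N
    (f : 'I_(nrows a) -> 'I_N) (g : 'I_(ncols a) -> 'I_N)
    (f' : 'I_(nrows b) -> 'I_N) (g' : 'I_(ncols b) -> 'I_N) :
  increasing f -> increasing g -> increasing f' -> increasing g' ->
  quasi_shuffle_mx (mx a) f g = quasi_shuffle_mx (mx b) f' g' -> a = b.
Proof.
move=> incf incg incf' incg' E.
have [If Ig] := (increasing_inj incf, increasing_inj incg).
have [If' Ig'] := (increasing_inj incf', increasing_inj incg').
have [rf cg] := quasi_shuffle_mx_image If Ig.
have [rf' cg'] := quasi_shuffle_mx_image If' Ig'.
have Er : [seq f i | i <- enum 'I_(nrows a)] = [seq f' i | i <- enum 'I_(nrows b)].
  by apply: increasing_enum_eq => // x; rewrite rf rf' E.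
have Ec : [seq g i | i <- enum 'I_(ncols a)] = [seq g' i | i <- enum 'I_(ncols b)].
  by apply: increasing_enum_eq => // x; rewrite cg cg' E.
have Enr : nrows a = nrows b.
  by move: (congr1 size Er); rewrite size_map size_map !size_enum_ord.
have Enc : ncols a = ncols b.
  by move: (congr1 size Ec); rewrite size_map size_map !size_enum_ord.
apply: mcomp_ext => // i j hi hj.
have hi' : (i < nrows b)%N by rewrite -Enr.
have hj' : (j < ncols b)%N by rewrite -Enc.
have key m n (h : 'I_m -> 'I_N) (h' : 'I_n -> 'I_N) k (km : (k < m)%N) (kn : (k < n)%N) :
  [seq h i | i <- enum 'I_m] = [seq h' i | i <- enum 'I_n] -> h (Ordinal km) = h' (Ordinal kn).
  move=> /(congr1 (fun s => nth (h (Ordinal km)) s k)).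
  rewrite (nth_map (Ordinal km)) ?size_enum_ord // (nth_map (Ordinal kn)) ?size_enum_ord //.
  by rewrite (nth_ord_enum _ (Ordinal km)) (nth_ord_enum _ (Ordinal kn)).
rewrite (entry_mx (Ordinal hi) (Ordinal hj)) (entry_mx (Ordinal hi') (Ordinal hj')).
rewrite -(quasi_shuffle_mxE _ _ _ If Ig) -(quasi_shuffle_mxE _ _ _ If' Ig') E.
by rewrite (key _ _ f f' i hi hi' Er) (key _ _ g g' j hj hj' Ec).
Qed.

Lemma placement_inj (a : mcomp d) N
    (f f' : {ffun 'I_(nrows a) -> 'I_N}) (g g' : {ffun 'I_(ncols a) -> 'I_N}) :
  increasing f -> increasing g -> increasing f' -> increasing g' ->
  quasi_shuffle_mx (mx a) f g = quasi_shuffle_mx (mx a) f' g' -> f = f' /\ g = g'.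
Proof.
move=> incf incg incf' incg' E.
have [rf cg] := quasi_shuffle_mx_image (increasing_inj incf) (increasing_inj incg).
have [rf' cg'] := quasi_shuffle_mx_image (increasing_inj incf') (increasing_inj incg').
by split; apply: increasing_eq => // x; rewrite ?rf ?cg ?rf' ?cg' E.
Qed.
End Placement.

(** * Commutativity and associativity of the quasi-shuffle *)

Section QuasiShuffleAlgebra.
Variables (K : comNzRingType) (d : nat).
Local Notation H := {malg K[mcomp d]}.

Definition quasi_shuffle_basis (a b : mcomp d) : H :=
  if a == empty_comp d then basis K b
  else if b == empty_comp d then basis K a
  else \sum_(1 <= j < (nrows a + nrows b).+1)
       \sum_(1 <= k < (ncols a + ncols b).+1)
       \sum_(p : qsh (nrows a) (nrows b) j)
       \sum_(q : qsh (ncols a) (ncols b) k) basis K (quasi_shuffle_comp p q).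

Lemma quasi_shuffleE : @quasi_shuffle K d = bilinear_ext quasi_shuffle_basis.
Proof. by []. Qed.

(** A two-parameter analogue of monomial quasi-symmetric polynomials, in [N] row and [N]
    column positions. *)
Definition placements N (a : mcomp d) : {malg K[pattern d N]} :=
  \sum_(f : {ffun 'I_(nrows a) -> 'I_N} | increasing f)
    \sum_(g : {ffun 'I_(ncols a) -> 'I_N} | increasing g)
      << quasi_shuffle_mx (mx a) f g : pattern d N >>.

Definition series N : H -> {malg K[pattern d N]} := linear_extension (placements N).
HB.instance Definition _ N := GRing.Linear.on (series N).

Lemma series_basis N a : series N (basis K a) = placements N a.
Proof. by rewrite basisE; apply: linear_extensionU. Qed.

Lemma placements_mul N a b : placements N a * placements N b =
  \sum_(F : {ffun 'I_(nrows a + nrows b) -> 'I_N} | increasing_on_blocks F)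
    \sum_(G : {ffun 'I_(ncols a + ncols b) -> 'I_N} | increasing_on_blocks G)
      << quasi_shuffle_mx (mx (diag a b)) F G : pattern d N >>.
Proof.
under [RHS]eq_bigr => F _.
  under eq_bigr => G _.
    have -> : quasi_shuffle_mx (mx (diag a b)) F G =
      mmul (quasi_shuffle_mx (mx a) [ffun i => F (lshift _ i)]
              [ffun i => G (lshift _ i)] : pattern d N)
           (quasi_shuffle_mx (mx b) [ffun i => F (rshift _ i)]
              [ffun i => G (rshift _ i)] : pattern d N).
      apply/matrixP => x y; rewrite pattern_mulE quasi_shuffle_mx_diag.
      by congr mmul; rewrite !mxE; do 2 (apply: eq_big => ?; rewrite ?ffunE // => _).
    over.
  rewrite -(sum_increasing_pair (fun g g' => << mmul
    (quasi_shuffle_mx (mx a) [ffun i => F (lshift _ i)] g : pattern d N)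
    (quasi_shuffle_mx (mx b) [ffun i => F (rshift _ i)] g' : pattern d N) >> :
    {malg K[pattern d N]})).
  over.
rewrite -(sum_increasing_pair (fun f f' => \sum_(g : {ffun _} | increasing g)
    \sum_(g' : {ffun _} | increasing g') << mmul
    (quasi_shuffle_mx (mx a) f g : pattern d N)
    (quasi_shuffle_mx (mx b) f' g' : pattern d N) >> : {malg K[pattern d N]})).
rewrite /placements mulr_suml; apply: eq_bigr => f _.
rewrite mulr_sumr; apply: eq_bigr => f' _.
rewrite mulr_suml; apply: eq_bigr => g _.
rewrite mulr_sumr; apply: eq_bigr => g' _.
exact: malgU_mul.
Qed.

Lemma placements_empty N : placements N (empty_comp d) = 1.
Proof.
rewrite /placements.
have f0 n : {ffun 'I_0 -> 'I_n} by apply: finfun => -[].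
rewrite (big_pred1 (f0 N)) => [|f]; last first.
  rewrite [RHS](_ : _ = true); first by apply/increasingP => -[].
  by apply/eqP/ffunP => -[].
rewrite (big_pred1 (f0 N)) => [|f]; last first.
  rewrite [RHS](_ : _ = true); first by apply/increasingP => -[].
  by apply/eqP/ffunP => -[].
congr << _ >>; apply/matrixP => i j; rewrite !mxE.
by apply: big1 => -[].
Qed.

(** A placement of [a] and a placement of [b] amount to maps of rows and columns that are
    increasing on blocks. Factoring both through their images reads the overlay as a placement
    of a term of the quasi-shuffle. *)
Lemma series_quasi_shuffle_basis N a b :
  series N (quasi_shuffle_basis a b) = placements N a * placements N b.
Proof.
rewrite /quasi_shuffle_basis; have [->|a0] := eqVneq a (empty_comp d).
  by rewrite placements_empty mul1r series_basis.
have [->|b0] := eqVneq b (empty_comp d).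
  by rewrite placements_empty mulr1 series_basis.
have r0 : (0 < nrows a)%N by rewrite lt0n nrows_eq0.
have c0 : (0 < ncols a)%N.
  by have [j hj _] := row_nontrivial r0; apply: leq_ltn_trans hj.
rewrite placements_mul sum_increasing_on_blocks // raddf_sum /=; apply: eq_bigr => j _.
rewrite raddf_sum /=.
under [RHS]eq_bigr => p _ do under eq_bigr => f _ do rewrite sum_increasing_on_blocks //.
under [RHS]eq_bigr => p _ do rewrite exchange_big.
rewrite [RHS]exchange_big; apply: eq_bigr => k _.
rewrite raddf_sum /=; apply: eq_bigr => p _.
rewrite raddf_sum /= exchange_big /=; apply: eq_bigr => q _.
rewrite series_basis; apply: eq_bigr => f _; apply: eq_bigr => g _.
congr << _ >>; rewrite quasi_shuffle_mx_comp.
apply/matrixP => x y; rewrite !mxE.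
by do 2 (apply: eq_big => ?; rewrite ?ffunE // => _).
Qed.

Lemma series_mul N x y : series N (quasi_shuffle x y) = series N x * series N y.
Proof.
rewrite quasi_shuffleE; move: x.
have lser := @linearP _ _ _ _ (series N).
apply: (linear_basis_eq (F := fun x => series N (bilinear_ext quasi_shuffle_basis x y))
  (G := fun x => series N x * series N y)).
- exact: linear_comp lser (@bilinear_linearl _ _ _ _).
- by move=> c x z; rewrite linearP mulrDl -scalerAl.
move=> a; move: y.
apply: (linear_basis_eq (F := fun y => series N (bilinear_ext quasi_shuffle_basis (basis K a) y))
  (G := fun y => series N (basis K a) * series N y)).
- exact: linear_comp lser (@bilinear_linearr _ _ _ _).
- by move=> c x z; rewrite linearP mulrDr -scalerAr.
move=> b; rewrite bilinear_extU series_quasi_shuffle_basis.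
by congr (_ * _); apply/esym/series_basis.
Qed.

(** For [N] large, [c] fits in the upper left corner, and this placement occurs in the series of
    no other composition. *)
Lemma series_inj (x y : H) : (forall N, series N x = series N y) -> x = y.
Proof.
move=> E; apply/eqP; rewrite -subr_eq0; apply/eqP.
have {E} : forall N, series N (x - y) = 0 by move=> N; rewrite linearB /= E subrr.
move: (x - y) => z E; apply/malgP => c; rewrite mcoeff0.
pose N := (nrows c + ncols c)%N.
pose f0 : {ffun 'I_(nrows c) -> 'I_N} := [ffun i => widen_ord (leq_addr _ _) i].
pose g0 : {ffun 'I_(ncols c) -> 'I_N} := [ffun i => widen_ord (leq_addl _ _) i].
have incf0 : increasing f0 by apply/increasingP => i i' ii'; rewrite !ffunE.
have incg0 : increasing g0 by apply/increasingP => i i' ii'; rewrite !ffunE.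
pose P : pattern d N := quasi_shuffle_mx (mx c) f0 g0.
have coef a : (placements N a)@_P =
    \sum_(f : {ffun 'I_(nrows a) -> 'I_N} | increasing f)
    \sum_(g : {ffun 'I_(ncols a) -> 'I_N} | increasing g)
      ((quasi_shuffle_mx (mx a) f g : pattern d N) == P)%:R.
  rewrite /placements raddf_sum; apply: eq_bigr => f _; rewrite raddf_sum.
  by apply: eq_bigr => g _; rewrite /= mcoeffU.
have cP : (placements N c)@_P = 1.
  rewrite coef (bigD1 f0) //= (bigD1 g0) //= eqxx.
  rewrite big1 => [|g /andP[incg gg0]]; last first.
    case: eqP => // /placement_inj[] // _ E0; by rewrite E0 eqxx in gg0.
  rewrite big1 ?addr0 // => f /andP[incf ff0]; apply: big1 => g incg.
  by case: eqP => // /placement_inj[] // E0; rewrite E0 eqxx in ff0.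
have := congr1 (mcoeff P) (E N); rewrite mcoeff0 /series /linear_extension raddf_sum /= => <-.
have := @linear_extension_single K _ K^o (fun a => (placements N a)@_P) z c.
rewrite {1}/linear_extension => Es.
under eq_bigr => a _ do rewrite mcoeffZ.
rewrite {}Es; first by rewrite cP /GRing.scale /= mulr1.
move=> a ac; rewrite coef big1 ?scaler0 // => f incf; apply: big1 => g incg.
by case: eqP => // /placement_inj_size E0; rewrite E0 ?eqxx // in ac.
Qed.

Lemma quasi_shuffleC : commutative (@quasi_shuffle K d).
Proof.
move=> x y; apply: series_inj => N.
apply: etrans (series_mul N x y) _; apply: etrans (mulrC _ _) _.
exact/esym/series_mul.
Qed.

Lemma quasi_shuffleA : associative (@quasi_shuffle K d).
Proof.
move=> x y z; apply: series_inj => N.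
apply: etrans (series_mul N _ _) _.
apply: etrans (congr1 (fun t => series N x * t) (series_mul N y z)) _.
apply: etrans (mulrA _ _ _) _.
apply: etrans (congr1 (fun t => t * series N z) (esym (series_mul N x y))) _.
exact/esym/series_mul.
Qed.

Lemma quasi_shuffle1 : left_id (unit_H K d) (@quasi_shuffle K d).
Proof.
rewrite quasi_shuffleE; apply: bilinear_left_unit => b.
by rewrite /quasi_shuffle_basis eqxx.
Qed.
End QuasiShuffleAlgebra.

(** * Blocks of quasi-shuffles *)

Section Interleaving.
Variable d : nat.
Local Notation M := {cmonom 'I_d}.
Implicit Types (a b c : mcomp d) (f g : nat -> nat) (A B E : nat -> nat -> M).
Implicit Types (i j x y m n r k : nat).

Lemma comp_of_entries r k E :
  (forall i, (i < r)%N -> exists2 j, (j < k)%N & E i j != mone) ->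
  (forall j, (j < k)%N -> exists2 i, (i < r)%N & E i j != mone) ->
  exists c, [/\ nrows c = r, ncols c = k &
    forall i j, (i < r)%N -> (j < k)%N -> entry c i j = E i j].
Proof.
move=> hr hc; pose X := \matrix_(i < r, j < k) E i j.
have hX : no_trivial_line X.
  apply/no_trivial_lineP; split=> z.
    by have [j hj nj] := hr _ (ltn_ord z); exists (Ordinal hj); rewrite mxE.
  by have [i hi ni] := hc _ (ltn_ord z); exists (Ordinal hi); rewrite mxE.
exists (MComp hX); split=> // i j hi hj.
by rewrite (entry_mx (c := MComp hX) (Ordinal hi) (Ordinal hj)) mxE.
Qed.

(** Both diagonal parts are compositions: a nontrivial entry in each of their lines exists in [a],
    and it lies in the part as the other parts are trivial. *)
Lemma split_comp a m n : (m <= nrows a)%N -> (n <= ncols a)%N ->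
  (forall i j, (i < m)%N -> (n <= j < ncols a)%N -> entry a i j = mone) ->
  (forall i j, (m <= i < nrows a)%N -> (j < n)%N -> entry a i j = mone) ->
  exists a1 a2, [/\ a = diag a1 a2, nrows a1 = m & ncols a1 = n].
Proof.
move=> hm hn ur dl.
have [||a1 [r1 k1 e1]] := @comp_of_entries m n (entry a).
- move=> i hi; have [j hj nj] := row_nontrivial (leq_trans hi hm); exists j => //.
  by rewrite ltnNge; apply: contraNN nj => nlej; rewrite ur ?nlej.
- move=> j hj; have [i hi ni] := col_nontrivial (leq_trans hj hn); exists i => //.
  by rewrite ltnNge; apply: contraNN ni => mlei; rewrite dl ?mlei.
have [||a2 [r2 k2 e2]] := @comp_of_entries (nrows a - m) (ncols a - n)
    (fun i j => entry a (m + i)%N (n + j)%N).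
- move=> i hi; have hi' : (m + i < nrows a)%N by rewrite -ltn_subRL.
  have [j hj nj] := row_nontrivial hi'.
  have nlej : (n <= j)%N.
    by rewrite leqNgt; apply: contraNN nj => jn; rewrite dl ?hi' ?leq_addr.
  by exists (j - n)%N; rewrite ?subnKC // ltn_sub2r // (leq_ltn_trans nlej).
- move=> j hj; have hj' : (n + j < ncols a)%N by rewrite -ltn_subRL.
  have [i hi ni] := col_nontrivial hj'.
  have mlei : (m <= i)%N.
    by rewrite leqNgt; apply: contraNN ni => im; rewrite ur ?hj' ?leq_addr.
  by exists (i - m)%N; rewrite ?subnKC // ltn_sub2r // (leq_ltn_trans mlei).
exists a1, a2; split=> //; apply: mcomp_ext => /=; rewrite ?r1 ?k1 ?r2 ?k2 ?subnKC // => i j hi hj.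
rewrite entry_diag r1 k1; case: ltnP => him; case: ltnP => hjn.
- by rewrite e1.
- by rewrite ur ?hjn.
- by rewrite dl ?him.
by rewrite e2 ?ltn_sub2r ?subnKC // ?(leq_ltn_trans him) ?(leq_ltn_trans hjn).
Qed.

Definition increasing_to m r f :=
  (forall i i', (i < i')%N -> (i' < m)%N -> (f i < f i')%N) /\
  (forall i, (i < m)%N -> (f i < r)%N).

Lemma increasing_threshold m r r1 f : increasing_to m r f ->
  exists2 m1, (m1 <= m)%N & forall i, (i < m)%N -> (f i < r1)%N = (i < m1)%N.
Proof.
elim: m => [|m IH] [incf fr]; first by exists 0%N.
have [|m1 m1m E] := IH.
  by split=> [i i' ii' i'm|i im]; [apply: incf | apply: fr]; rewrite // ltnS ltnW.
have [fm|fm] := ltnP (f m) r1.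
  exists m.+1 => // i im; rewrite im.
  by move: im; rewrite ltnS leq_eqVlt => /predU1P[->//|im]; apply: ltn_trans fm; apply: incf.
exists m1 => [|i]; first exact: leqW.
rewrite ltnS leq_eqVlt => /predU1P[->|/E //].
by rewrite !ltnNge fm m1m.
Qed.

Lemma increasing_to_id m r f : increasing_to m r f ->
  (forall x, (x < r)%N -> exists2 i, (i < m)%N & f i = x) ->
  m = r /\ (forall i, (i < m)%N -> f i = i).
Proof.
move=> [incf fr] sf.
have E : map f (iota 0 m) = iota 0 r.
  apply: (irr_sorted_eq ltn_trans ltnn); last first.
  - move=> x; rewrite mem_iota /=; apply/mapP/idP => [[i]|/sf[i im <-]].
      by rewrite mem_iota /= => /fr h ->.
    by exists i; rewrite ?mem_iota.
  - exact: iota_ltn_sorted.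
  rewrite sorted_map; apply: (sub_in_sorted (P := [pred i | i < m]%N) (e := ltn)).
  - by move=> i i' /= _ i'm ii'; apply: incf.
  - by apply/allP => i; rewrite mem_iota.
  - exact: iota_ltn_sorted.
have Em : m = r by move: (congr1 size E); rewrite size_map !size_iota.
split=> // i im; have := congr1 (fun s => nth 0%N s i) E.
by rewrite (nth_map 0%N) ?size_iota // !nth_iota // -?Em.
Qed.

(** A placement in an [r] by [k] matrix with entries [A], in terms of total functions on natural
    numbers: splitting a composition into diagonal parts then needs no transport between
    ordinals. *)
Record placed a r k f g A : Prop := Placed {
  placed_rows : increasing_to (nrows a) r f;
  placed_cols : increasing_to (ncols a) k g;
  placed_entry : forall i j, (i < nrows a)%N -> (j < ncols a)%N ->
    A (f i) (g j) = entry a i j;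
  placed_row_out : forall x y, (x < r)%N -> (y < k)%N ->
    (forall i, (i < nrows a)%N -> f i <> x) -> A x y = mone;
  placed_col_out : forall x y, (x < r)%N -> (y < k)%N ->
    (forall j, (j < ncols a)%N -> g j <> y) -> A x y = mone }.

(** Rows and columns are placed in order, so those landing in the first diagonal part of [A] are
    initial segments, and [a] splits along them. *)
Lemma placed_split a r1 r2 k1 k2 f g A : placed a (r1 + r2) (k1 + k2) f g A ->
  (forall x y, (x < r1)%N -> (k1 <= y < k1 + k2)%N -> A x y = mone) ->
  (forall x y, (r1 <= x < r1 + r2)%N -> (y < k1)%N -> A x y = mone) ->
  exists a1 a2 f2 g2, [/\ a = diag a1 a2, placed a1 r1 k1 f g A
    & placed a2 r2 k2 f2 g2 (fun x y => A (r1 + x)%N (k1 + y)%N)].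
Proof.
case=> incf incg ent rout cout ur dl.
have [m1 m1m fm] := increasing_threshold r1 incf.
have [n1 n1n gn] := increasing_threshold k1 incg.
case: incf incg => [incf fr] [incg gr].
have fge i : (m1 <= i < nrows a)%N -> (r1 <= f i)%N.
  by case/andP=> mi im; rewrite leqNgt fm // -leqNgt.
have gge j : (n1 <= j < ncols a)%N -> (k1 <= g j)%N.
  by case/andP=> nj jn; rewrite leqNgt gn // -leqNgt.
have [||a1 [a2 [Ea Em En]]] := @split_comp a m1 n1 m1m n1n.
- move=> i j im /[dup] /gge jge /andP[_ jn].
  have ia := leq_trans im m1m.
  by rewrite -ent // ur ?fm // jge gr.
- move=> i j /[dup] /fge ige /andP[_ im] jn.
  have ja := leq_trans jn n1n.
  by rewrite -ent // dl ?gn // ige fr.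
have Er : nrows a = (m1 + nrows a2)%N by rewrite Ea /= Em.
have Ec : ncols a = (n1 + ncols a2)%N by rewrite Ea /= En.
have im1 i : (i < m1)%N -> (i < nrows a)%N by move=> h; apply: leq_trans m1m.
have jn1 j : (j < n1)%N -> (j < ncols a)%N by move=> h; apply: leq_trans n1n.
have im2 i : (i < nrows a2)%N -> (m1 <= m1 + i < nrows a)%N.
  by move=> h; rewrite leq_addr Er ltn_add2l.
have jn2 j : (j < ncols a2)%N -> (n1 <= n1 + j < ncols a)%N.
  by move=> h; rewrite leq_addr Ec ltn_add2l.
exists a1, a2, (fun i => f (m1 + i) - r1)%N, (fun j => g (n1 + j) - k1)%N; split=> //.
- split; rewrite ?Em ?En.
  + split=> [i i' ii' /im1|i im]; first exact: incf.
    by rewrite fm ?im1.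
  + split=> [i i' ii' /jn1|i im]; first exact: incg.
    by rewrite gn ?jn1.
  + move=> i j im jn; rewrite ent ?im1 ?jn1 //.
    by rewrite Ea entry_diag Em En im jn.
  + move=> x y xr yk h; apply: rout; rewrite ?ltn_addr // => i ia fx.
    by apply: (h i) => //; rewrite -fm // fx.
  + move=> x y xr yk h; apply: cout; rewrite ?ltn_addr // => i ia gx.
    by apply: (h i) => //; rewrite -gn // gx.
have f2K i : (i < nrows a2)%N -> (r1 + (f (m1 + i) - r1))%N = f (m1 + i)%N.
  by move=> h; rewrite subnKC // fge ?im2.
have g2K j : (j < ncols a2)%N -> (k1 + (g (n1 + j) - k1))%N = g (n1 + j)%N.
  by move=> h; rewrite subnKC // gge ?jn2.
split.
- split=> [i i' ii' h|i h].
    have [h1 h2] := (ltn_trans ii' h, im2 _ h).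
    rewrite -(ltn_add2l r1) !f2K //; apply: incf; rewrite ?ltn_add2l //.
    by case/andP: h2.
  by rewrite -(ltn_add2l r1) f2K // fr //; case/andP: (im2 _ h).
- split=> [i i' ii' h|i h].
    have [h1 h2] := (ltn_trans ii' h, jn2 _ h).
    rewrite -(ltn_add2l k1) !g2K //; apply: incg; rewrite ?ltn_add2l //.
    by case/andP: h2.
  by rewrite -(ltn_add2l k1) g2K // gr //; case/andP: (jn2 _ h).
- move=> i j im jn; rewrite f2K // g2K //.
  have [/andP[_ h1] /andP[_ h2]] := (im2 _ im, jn2 _ jn).
  by rewrite ent // Ea entry_diag Em En !ltnNge !leq_addr /= !addKn.
- move=> x y xr yk h; apply: rout; rewrite ?ltn_add2l // => i ia fi.
  have mi : (m1 <= i)%N by rewrite leqNgt -fm // fi -leqNgt leq_addr.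
  apply: (h (i - m1)%N); first by rewrite -(ltn_add2l m1) subnKC // -Er.
  by rewrite subnKC // fi addKn.
- move=> x y xr yk h; apply: cout; rewrite ?ltn_add2l // => i ia gi.
  have ni : (n1 <= i)%N by rewrite leqNgt -gn // gi -leqNgt leq_addr.
  apply: (h (i - n1)%N); first by rewrite -(ltn_add2l n1) subnKC // -Ec.
  by rewrite subnKC // gi addKn.
Qed.

(** The matrix of [c] is the overlay of a placement of [a] and a placement of [b]: this is how
    terms of the shuffle and of the quasi-shuffle arise. *)
Definition interleaves a b c := exists fa ga fb gb A B,
  [/\ placed a (nrows c) (ncols c) fa ga A, placed b (nrows c) (ncols c) fb gb B
    & forall x y, (x < nrows c)%N -> (y < ncols c)%N ->
      entry c x y = mmul (A x y) (B x y)].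

Lemma interleaves_sym a b c : interleaves a b c -> interleaves b a c.
Proof.
case=> fa [ga [fb [gb [A [B [pA pB E]]]]]]; exists fb, gb, fa, ga, B, A; split=> //.
by move=> x y hx hy; rewrite E // mulmC.
Qed.

(** All lines of [c] are nontrivial, so the placement of [a] is onto, hence the identity. *)
Lemma interleaves_empty a c : interleaves a (empty_comp d) c -> a = c.
Proof.
case=> fa [ga [fb [gb [A [B [pA pB E]]]]]].
have EA x y : (x < nrows c)%N -> (y < ncols c)%N -> entry c x y = A x y.
  by move=> hx hy; rewrite E // (placed_row_out pB) // mulm1.
have [|Er fid] := increasing_to_id (placed_rows pA).
  move=> x hx; have [y hy ny] := row_nontrivial hx.
  apply: contrapT => nex; move/negP: ny; apply; rewrite EA // (placed_row_out pA) // => i hi fi.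
  by apply: nex; exists i.
have [|Ec gid] := increasing_to_id (placed_cols pA).
  move=> y hy; have [x hx nx] := col_nontrivial hy.
  apply: contrapT => nex; move/negP: nx; apply; rewrite EA // (placed_col_out pA) // => i hi gi.
  by apply: nex; exists i.
apply: mcomp_ext => // i j hi hj.
by rewrite EA -?Er -?Ec // -(placed_entry pA) // fid // gid.
Qed.

(** The entries of [c] outside of the diagonal parts are trivial products, so both placements
    are trivial there and split. *)
Lemma interleaves_diag a b c1 c2 : interleaves a b (diag c1 c2) ->
  exists a1 a2 b1 b2, [/\ a = diag a1 a2, b = diag b1 b2,
    interleaves a1 b1 c1 & interleaves a2 b2 c2].
Proof.
case=> fa [ga [fb [gb [A [B [/= pA pB E]]]]]].
have ur x y : (x < nrows c1)%N -> (ncols c1 <= y < ncols c1 + ncols c2)%N ->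
    A x y = mone /\ B x y = mone.
  move=> hx /andP[hy hy']; apply: unitm; rewrite -E ?(ltn_addr _ hx) //.
  by rewrite entry_diag hx ltnNge hy.
have dl x y : (nrows c1 <= x < nrows c1 + nrows c2)%N -> (y < ncols c1)%N ->
    A x y = mone /\ B x y = mone.
  move=> /andP[hx hx'] hy; apply: unitm; rewrite -E ?(ltn_addr _ hy) //.
  by rewrite entry_diag hy ltnNge hx.
have [||a1 [a2 [fa2 [ga2 [Ea pA1 pA2]]]]] := placed_split pA.
- by move=> x y hx hy; have [] := ur x y hx hy.
- by move=> x y hx hy; have [] := dl x y hx hy.
have [||b1 [b2 [fb2 [gb2 [Eb pB1 pB2]]]]] := placed_split pB.
- by move=> x y hx hy; have [] := ur x y hx hy.
- by move=> x y hx hy; have [] := dl x y hx hy.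
exists a1, a2, b1, b2; split=> //.
  exists fa, ga, fb, gb, A, B; split=> // x y hx hy.
  by rewrite -E ?ltn_addr // entry_diag hx hy.
exists fa2, ga2, fb2, gb2, (fun x y => A (nrows c1 + x)%N (ncols c1 + y)%N),
  (fun x y => B (nrows c1 + x)%N (ncols c1 + y)%N); split=> // x y hx hy.
by rewrite -E ?ltn_add2l // entry_diag !ltnNge !leq_addr /= !addKn.
Qed.

Lemma placed_empty a k f g A : placed a 0 k f g A -> a = empty_comp d.
Proof.
move=> /placed_rows[_ fr]; apply/eqP; rewrite -nrows_eq0 -leqn0 leqNgt.
by apply/negP => /fr.
Qed.

Lemma size_blocks_gt0 a : a <> empty_comp d -> (0 < size (blocks a))%N.
Proof. by move=> a0; rewrite lt0n size_eq0; apply/eqP => /blocks_nil. Qed.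

(** Peel off the first block [x] of the word, an overlay of parts [a1] and [b1] that are not both
    empty. If one of them is empty then [x] is the other; otherwise [x] consumes at least two
    blocks, and the length drops. *)
Lemma interleaves_diags w a b : interleaves a b (diags w) ->
  (size w < size (blocks a) + size (blocks b))%N \/ shuf (blocks a) (blocks b) w.
Proof.
elim: w a b => [|x w IH] a b /=.
  case=> fa [ga [fb [gb [A [B [/placed_empty -> /placed_empty -> _]]]]]].
  by right; rewrite blocks_empty; constructor.
case/interleaves_diag=> a1 [a2 [b1 [b2 [-> -> H1 /IH H2]]]].
rewrite !blocks_diag.
have x0 : val x <> empty_comp d by move=> E; have /andP[/eqP] := valP x.
have [b1E|b1n] := pselect (b1 = empty_comp d).
  subst b1; rewrite (interleaves_empty H1) blocks_empty /=.
  have -> : blocks (val x) = [:: x] by rewrite -[RHS]diagsK /= diage.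
  by case: H2 => [lt_w|sh]; [left | right; constructor].
have [a1E|a1n] := pselect (a1 = empty_comp d).
  subst a1; rewrite (interleaves_empty (interleaves_sym H1)) blocks_empty /=.
  have -> : blocks (val x) = [:: x] by rewrite -[RHS]diagsK /= diage.
  by case: H2 => [lt_w|sh]; [left; rewrite addnS ltnS | right; constructor].
left; have le_w : (size w <= size (blocks a2) + size (blocks b2))%N.
  by case: H2 => [/ltnW|/shuf_size ->].
rewrite !size_cat addnACA.
have le_2 := leq_add (size_blocks_gt0 a1n) (size_blocks_gt0 b1n).
exact: leq_trans (leq_add le_2 le_w).
Qed.

Lemma interleaves_blocks a b c : interleaves a b c -> shuffle_bound a b c.
Proof. by rewrite -{1}(blocksK c) => /interleaves_diags. Qed.

Definition extend_nat m r (f : 'I_m -> 'I_r) i : nat :=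
  if insub i is Some i' then f i' else 0%N.

Lemma extend_natE m r (f : 'I_m -> 'I_r) i (hi : (i < m)%N) :
  extend_nat f i = f (Ordinal hi).
Proof. by rewrite /extend_nat insubT. Qed.

Lemma extend_nat_increasing m r (f : 'I_m -> 'I_r) : increasing f ->
  increasing_to m r (extend_nat f).
Proof.
move=> /increasingP incf; split=> [i i' ii' hi'|i hi]; last by rewrite extend_natE.
by rewrite (extend_natE _ (ltn_trans ii' hi')) (extend_natE _ hi') incf.
Qed.

Definition extend_mx r k (X : 'M[M]_(r, k)) x y : M :=
  if insub x is Some x' then if insub y is Some y' then X x' y' else mone else mone.

Lemma extend_mxE r k (X : 'M[M]_(r, k)) x y (hx : (x < r)%N) (hy : (y < k)%N) :
  extend_mx X x y = X (Ordinal hx) (Ordinal hy).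
Proof. by rewrite /extend_mx insubT insubT. Qed.

Lemma placed_quasi_shuffle_mx a r k (f : 'I_(nrows a) -> 'I_r) (g : 'I_(ncols a) -> 'I_k) :
  increasing f -> increasing g ->
  placed a r k (extend_nat f) (extend_nat g) (extend_mx (quasi_shuffle_mx (mx a) f g)).
Proof.
move=> incf incg; split.
- exact: extend_nat_increasing.
- exact: extend_nat_increasing.
- move=> i j hi hj; rewrite (extend_natE _ hi) (extend_natE _ hj).
  rewrite (extend_mxE _ (ltn_ord _) (ltn_ord _)) (entry_mx (Ordinal hi) (Ordinal hj)).
  rewrite -(quasi_shuffle_mxE _ _ _ (increasing_inj incf) (increasing_inj incg)).
  by congr (quasi_shuffle_mx _ _ _ _ _); apply: val_inj.
- move=> x y hx hy nx; rewrite (extend_mxE _ hx hy); apply/eqP; apply: contraT.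
  case/quasi_shuffle_mx_row=> [[u fu] _]; case: (nx u (ltn_ord u)).
  rewrite (extend_natE _ (ltn_ord u)) (_ : Ordinal _ = u) ?fu //; exact: val_inj.
move=> x y hx hy ny; rewrite (extend_mxE _ hx hy); apply/eqP; apply: contraT.
case/quasi_shuffle_mx_row=> [_ [v gv]]; case: (ny v (ltn_ord v)).
rewrite (extend_natE _ (ltn_ord v)) (_ : Ordinal _ = v) ?gv //; exact: val_inj.
Qed.

Lemma interleaves_quasi_shuffle_mx a b c
    (p : 'I_(nrows a + nrows b) -> 'I_(nrows c)) (q : 'I_(ncols a + ncols b) -> 'I_(ncols c)) :
  increasing_on_blocks p -> increasing_on_blocks q ->
  mx c = quasi_shuffle_mx (mx (diag a b)) p q -> interleaves a b c.
Proof.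
move=> /andP[pa pb] /andP[qa qb] E.
do 6! eexists; split.
- exact: placed_quasi_shuffle_mx pa qa.
- exact: placed_quasi_shuffle_mx pb qb.
move=> x y hx hy; rewrite (entry_mx (Ordinal hx) (Ordinal hy)) E.
by rewrite !(extend_mxE _ hx hy) -quasi_shuffle_mx_diag.
Qed.
End Interleaving.

(** * Terms of the shuffle and of the quasi-shuffle *)

Section BasisProducts.
Variables (K : comNzRingType) (d : nat).
Local Notation H := {malg K[mcomp d]}.
Implicit Types (a b c : mcomp d).

Lemma MComp_inj m n (A B : 'M[{cmonom 'I_d}]_(m, n)) hA hB : A = B ->
  MComp (mx := A) hA = MComp (mx := B) hB.
Proof. by move=> E; case: B / E hB => hB; rewrite (bool_irrelevance hA hB). Qed.

Lemma quasi_shuffle_comp_interleaves a b j k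
    (p : qsh (nrows a) (nrows b) j) (q : qsh (ncols a) (ncols b) k) :
  interleaves a b (quasi_shuffle_comp p q).
Proof.
have /andP[_ hp] := valP p; have /andP[_ hq] := valP q.
exact: (@interleaves_quasi_shuffle_mx _ a b (quasi_shuffle_comp p q) _ _ hp hq erefl).
Qed.

Lemma increasing_on_blocks_id m s : increasing_on_blocks (fun u : 'I_(m + s) => u).
Proof.
apply/andP; split; apply/forallP => i; apply/forallP => i'; apply/implyP => //=.
by rewrite ltn_add2l.
Qed.

Lemma quasi_shuffle_mx_id m n (D : 'M[{cmonom 'I_d}]_(m, n)) p q :
  p =1 id -> q =1 id -> quasi_shuffle_mx D p q = D.
Proof.
move=> pE qE; apply/matrixP => x y; rewrite mxE (big_pred1 x) => [|u]; last by rewrite /= pE.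
by rewrite (big_pred1 y) // => v; rewrite /= qE.
Qed.

Lemma qsh_id_subproof m s : let f := [ffun u : 'I_(m + s) => u] in
  surjectiveb f && increasing_on_blocks f.
Proof.
apply/andP; split.
  by apply/forallP => u; apply/existsP; exists u; rewrite ffunE.
have := increasing_on_blocks_id m s; congr (_ && _);
  by apply: eq_forallb => i; apply: eq_forallb => i'; rewrite !ffunE.
Qed.

Definition qsh_id m s : qsh m s (m + s) :=
  exist _ [ffun u : 'I_(m + s) => u] (qsh_id_subproof m s).

Lemma quasi_shuffle_comp_id a b :
  quasi_shuffle_comp (qsh_id (nrows a) (nrows b)) (qsh_id (ncols a) (ncols b)) = diag a b.
Proof.
by apply: MComp_inj; apply: quasi_shuffle_mx_id => u; rewrite /= ffunE.
Qed.

Lemma ncols_gt0 a : a != empty_comp d -> (0 < ncols a)%N.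
Proof.
rewrite -nrows_eq0 -lt0n => /row_nontrivial[j hj _]; exact: leq_ltn_trans hj.
Qed.

Lemma quasi_shuffle_basis_sum a b :
  basis_sum_with (shuffle_bound a b) (diag a b) (quasi_shuffle_basis K a b).
Proof.
rewrite /quasi_shuffle_basis; have [->|a0] := eqVneq a (empty_comp d).
  by rewrite diag0; apply: basis_sum_with_basis; apply: shuffle_bound_0l.
have [->|b0] := eqVneq b (empty_comp d).
  by rewrite diage; apply: basis_sum_with_basis; apply: shuffle_bound_0r.
have ok j k (p : qsh (nrows a) (nrows b) j) (q : qsh (ncols a) (ncols b) k) :
    shuffle_bound a b (quasi_shuffle_comp p q).
  by apply: interleaves_blocks; apply: quasi_shuffle_comp_interleaves.
apply: (basis_sum_with_sum (i0 := (nrows a + nrows b)%N)) => // [||j _].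
- by rewrite mem_index_iota ltnSn andbT addn_gt0 lt0n nrows_eq0 a0.
- apply: (basis_sum_with_sum (i0 := (ncols a + ncols b)%N)) => // [||k _].
  + by rewrite mem_index_iota ltnSn andbT addn_gt0 ncols_gt0.
  + apply: (basis_sum_with_sum (i0 := qsh_id _ _)) => // [||p _].
    * exact: mem_index_enum.
    * apply: (basis_sum_with_sum (i0 := qsh_id _ _)) => // [||q _].
      - exact: mem_index_enum.
      - rewrite -{1}(quasi_shuffle_comp_id a b); apply: basis_sum_with_basis; exact: ok.
      exact: basis_sum_of_basis.
    by apply: basis_sum_of_sum => q _; apply: basis_sum_of_basis.
  by do 2! (apply: basis_sum_of_sum => ? _); apply: basis_sum_of_basis.
by do 3! (apply: basis_sum_of_sum => ? _); apply: basis_sum_of_basis.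
Qed.

Definition shuffle_basis a b : H :=
  if a == empty_comp d then basis K b
  else if b == empty_comp d then basis K a
  else \sum_(p in sh (nrows a) (nrows b)) \sum_(q in sh (ncols a) (ncols b))
         basis K (shuffle_comp (c := diag a b) p q).

Lemma shuffle_mx_quasi m n (D : 'M[{cmonom 'I_d}]_(m, n)) (p : 'S_m) (q : 'S_n) :
  shuffle_mx D p q = quasi_shuffle_mx D p q.
Proof.
apply/matrixP => x y; rewrite !mxE (big_pred1 (p^-1%g x)) => [|u]; last first.
  by rewrite /= (can2_eq (permK p) (permKV p)).
by rewrite (big_pred1 (q^-1%g y)) // => v; rewrite /= (can2_eq (permK q) (permKV q)).
Qed.

Lemma shuffle_comp_interleaves a b (p : 'S_(nrows a + nrows b)) (q : 'S_(ncols a + ncols b)) :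
  p \in sh (nrows a) (nrows b) -> q \in sh (ncols a) (ncols b) ->
  interleaves a b (shuffle_comp (c := diag a b) p q).
Proof.
rewrite !inE => hp hq.
apply: (@interleaves_quasi_shuffle_mx _ a b (shuffle_comp (c := diag a b) p q) p q hp hq).
exact: shuffle_mx_quasi.
Qed.

Lemma sh_id m s : 1%g \in sh m s.
Proof.
rewrite inE; have := increasing_on_blocks_id m s; congr (_ && _);
  by apply: eq_forallb => i; apply: eq_forallb => i'; rewrite !perm1.
Qed.

Lemma shuffle_comp_id a b : shuffle_comp (c := diag a b) 1 1 = diag a b.
Proof.
apply: MComp_inj; rewrite shuffle_mx_quasi.
by apply: quasi_shuffle_mx_id => u; rewrite perm1.
Qed.

Lemma shuffle_basis_sum a b :
  basis_sum_with (shuffle_bound a b) (diag a b) (shuffle_basis a b).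
Proof.
rewrite /shuffle_basis; have [->|a0] := eqVneq a (empty_comp d).
  by rewrite diag0; apply: basis_sum_with_basis; apply: shuffle_bound_0l.
have [->|b0] := eqVneq b (empty_comp d).
  by rewrite diage; apply: basis_sum_with_basis; apply: shuffle_bound_0r.
have ok p q : p \in sh (nrows a) (nrows b) -> q \in sh (ncols a) (ncols b) ->
    shuffle_bound a b (shuffle_comp (c := diag a b) p q).
  by move=> hp hq; apply: interleaves_blocks; apply: shuffle_comp_interleaves.
apply: (basis_sum_with_sum (i0 := 1%g)) => [|||p hp]; rewrite ?mem_index_enum ?sh_id //.
  apply: (basis_sum_with_sum (i0 := 1%g)) => [|||q hq]; rewrite ?mem_index_enum ?sh_id //.
    rewrite -{1}(shuffle_comp_id a b); apply: basis_sum_with_basis; apply: ok; exact: sh_id.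
  by apply: basis_sum_of_basis; apply: ok => //; apply: sh_id.
by apply: basis_sum_of_sum => q hq; apply: basis_sum_of_basis; apply: ok.
Qed.
End BasisProducts.

(** * The shuffle as the part of largest size of the quasi-shuffle *)

Section ShuffleAlgebra.
Variables (K : comNzRingType) (d : nat).
Local Notation H := {malg K[mcomp d]}.
Local Notation Q := (@quasi_shuffle K d).
Local Notation S := (@shuffle K d).
Implicit Types (a b c e : mcomp d) (x y z : H).

Lemma qsh_inj m s (p : qsh m s (m + s)) : injective (val p).
Proof.
have : {in [set: 'I_(m + s)] &, injective (val p)}.
  apply/imset_injP; rewrite cardsT (_ : _ @: _ = setT) ?cardsT //.
  apply/setP => x; rewrite inE; apply/imsetP.
  by have /forallP/(_ x)/existsP[u /eqP <-] := qsh_surj p; exists u.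
by move=> inj u v; apply: inj; rewrite inE.
Qed.

Definition qsh_perm m s (p : qsh m s (m + s)) : 'S_(m + s) := perm (@qsh_inj m s p).

Lemma sum_sh (V : nmodType) m s (F : 'S_(m + s) -> V) :
  \sum_(p in sh m s) F p = \sum_(p : qsh m s (m + s)) F (qsh_perm p).
Proof.
have inj : injective (@qsh_perm m s).
  move=> p q /permP E; apply: val_inj; apply/ffunP => u.
  by have := E u; rewrite !permE.
transitivity (\sum_(p in @qsh_perm m s @: setT) F p).
  apply: eq_bigl => p; rewrite inE; apply/idP/imsetP => [hp|[q _ ->]].
    have hq : surjectiveb [ffun u => p u] && increasing_on_blocks [ffun u => p u].
      apply/andP; split.
        by apply/forallP => u; apply/existsP; exists (p^-1%g u); rewrite ffunE permKV.
      move: hp; congr (_ && _);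
        by apply: eq_forallb => i; apply: eq_forallb => i'; rewrite !ffunE.
    exists (exist _ [ffun u => p u] hq) => //.
    by apply/permP => u; rewrite permE /= ffunE.
  have /andP[_] := valP q; congr (_ && _);
    by apply: eq_forallb => i; apply: eq_forallb => i'; rewrite !permE.
rewrite big_imset /=; first by apply: eq_bigl => p; rewrite inE.
by move=> p q _ _; apply: inj.
Qed.

Definition size_part r k : H -> H :=
  linear_extension (fun c => if (nrows c == r) && (ncols c == k) then basis K c else 0).
HB.instance Definition _ r k := GRing.Linear.on (size_part r k).

Lemma size_part_basis r k c : size_part r k (basis K c) =
  if (nrows c == r) && (ncols c == k) then basis K c else 0.
Proof. by rewrite [X in size_part _ _ X]basisE; apply: linear_extensionU. Qed.

Lemma shuffleE : S = bilinear_ext (@shuffle_basis K d).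
Proof. by []. Qed.

(** A surjection onto an interval of the same size is a permutation. *)
Lemma shuffle_basis_size_part a b : shuffle_basis K a b =
  size_part (nrows a + nrows b)%N (ncols a + ncols b)%N (quasi_shuffle_basis K a b).
Proof.
rewrite /shuffle_basis /quasi_shuffle_basis.
have [->|a0] := eqVneq a (empty_comp d); first by rewrite size_part_basis !eqxx.
have [->|b0] := eqVneq b (empty_comp d).
  by rewrite size_part_basis /= !addn0 !eqxx.
have r0 : (0 < nrows a + nrows b)%N by rewrite addn_gt0 lt0n nrows_eq0 a0.
have c0 : (0 < ncols a + ncols b)%N by rewrite addn_gt0 ncols_gt0.
apply/esym; rewrite raddf_sum big_nat_recr //= big_nat_cond big1 => [|j]; last first.
  rewrite andbT => /andP[_ lt_j]; rewrite raddf_sum; apply: big1 => k _.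
  rewrite raddf_sum; apply: big1 => p _; rewrite raddf_sum; apply: big1 => q _.
  by rewrite /= size_part_basis /= (ltn_eqF lt_j).
rewrite add0r raddf_sum big_nat_recr //= big_nat_cond big1 => [|k]; last first.
  rewrite andbT => /andP[_ lt_k].
  rewrite raddf_sum; apply: big1 => p _; rewrite raddf_sum; apply: big1 => q _.
  by rewrite /= size_part_basis /= (ltn_eqF lt_k) andbF.
rewrite add0r raddf_sum sum_sh; apply: eq_bigr => p _.
rewrite raddf_sum sum_sh; apply: eq_bigr => q _.
rewrite /= size_part_basis /= !eqxx; congr basis; apply: MComp_inj.
rewrite shuffle_mx_quasi; apply/matrixP => x y; rewrite !mxE.
by do 2 (apply: eq_big => ?; rewrite ?permE // => _).
Qed.

Lemma quasi_shuffle_basisE a b : quasi_shuffle_basis K a b = Q (basis K a) (basis K b).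
Proof. by rewrite quasi_shuffleE bilinear_extU. Qed.

Lemma shuffle_basisE a b : shuffle_basis K a b = S (basis K a) (basis K b).
Proof. by rewrite shuffleE bilinear_extU. Qed.

Lemma shuffleC : commutative S.
Proof.
rewrite shuffleE; apply: bilinear_commutative => a b.
rewrite !shuffle_basis_size_part !quasi_shuffle_basisE.
apply: etrans (congr1 (size_part _ _) (quasi_shuffleC _ _)) _.
by rewrite (addnC (nrows a)) (addnC (ncols a)).
Qed.

Definition size_le r k c := (nrows c <= r)%N /\ (ncols c <= k)%N.

Lemma quasi_shuffle_basis_size a b :
  basis_sum_of (size_le (nrows a + nrows b)%N (ncols a + ncols b)%N) (quasi_shuffle_basis K a b).
Proof.
rewrite /quasi_shuffle_basis; case: eqP => [->|_].
  by apply: basis_sum_of_basis; split.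
case: eqP => [->|_].
  by apply: basis_sum_of_basis; split; rewrite /= addn0.
rewrite big_nat_cond; apply: basis_sum_of_sum => j; rewrite andbT ltnS => /andP[_ le_j].
rewrite big_nat_cond; apply: basis_sum_of_sum => k; rewrite andbT ltnS => /andP[_ le_k].
by do 2 (apply: basis_sum_of_sum => ? _); apply: basis_sum_of_basis; split.
Qed.

(** Terms of smaller size remain too small after multiplication, so taking the part of largest
    size commutes with products: this transfers associativity. *)
Lemma size_part_quasi_shuffle r k x e : basis_sum_of (size_le r k) x ->
  size_part (r + nrows e)%N (k + ncols e)%N (Q x (basis K e)) = S (size_part r k x) (basis K e).
Proof.
case=> s -> sP.
have linL : linear (fun x => size_part (r + nrows e)%N (k + ncols e)%N (Q x (basis K e))).
  exact: linear_comp (@linearP _ _ _ _ (size_part _ _)) (@bilinear_linearl _ _ _ _).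
have linR : linear (fun x => S (size_part r k x) (basis K e)).
  exact: (linear_comp (F := S^~ (basis K e)) (@bilinear_linearl _ _ _ _)
    (@linearP _ _ _ _ (size_part _ _))).
apply: etrans (linear_big _ _ linL) _; apply: etrans (esym (linear_big _ _ linR)).
apply: eq_big_seq => c /sP[le_r le_k].
rewrite -quasi_shuffle_basisE size_part_basis; case: ifPn => [/andP[/eqP <- /eqP <-]|ne].
  by rewrite -shuffle_basisE shuffle_basis_size_part.
apply: etrans (esym (linear_map0 (@bilinear_linearl K d (@shuffle_basis K d) (basis K e)))).
 have [t -> tP] := quasi_shuffle_basis_size c e.
rewrite raddf_sum big_seq; apply: big1 => f /tP[fr fk]; rewrite /= size_part_basis.
case: ifPn => // /andP[/eqP Er /eqP Ek]; case/negP: ne.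
rewrite Er leq_add2r in fr; rewrite Ek leq_add2r in fk.
by rewrite !eqn_leq le_r le_k fr fk.
Qed.

Lemma shuffleA : associative S.
Proof.
rewrite shuffleE; apply: bilinear_associative => a b c; rewrite -shuffleE.
have part u v w : S (S (basis K u) (basis K v)) (basis K w) =
    size_part (nrows u + nrows v + nrows w)%N (ncols u + ncols v + ncols w)%N
      (Q (Q (basis K u) (basis K v)) (basis K w)).
  rewrite -shuffle_basisE shuffle_basis_size_part -quasi_shuffle_basisE.
  by rewrite -size_part_quasi_shuffle //; apply: quasi_shuffle_basis_size.
apply: etrans (shuffleC _ _) _.
apply: etrans (part b c a) _; apply: etrans _ (esym (part a b c)).
have rot m n p : (m + n + p = p + m + n)%N by rewrite addnC addnA.
rewrite (rot (nrows b)) (rot (ncols b)).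
have E : Q (Q (basis K b) (basis K c)) (basis K a) = Q (Q (basis K a) (basis K b)) (basis K c).
  by apply: etrans (quasi_shuffleC _ _) _; apply: quasi_shuffleA.
exact: congr1 E.
Qed.

Lemma shuffle1 : left_id (unit_H K d) S.
Proof.
rewrite shuffleE; apply: bilinear_left_unit => b.
by rewrite /shuffle_basis eqxx.
Qed.
End ShuffleAlgebra.

(** * The block shuffle *)

(** Associativity for words of first letters [a], [b], [c] from the three cases with one letter
    less: both sides expand into one term for each possible first letter. The maps [Da], [Db],
    [Dc] prepend the letters. *)
Lemma shuffle_associative_step (V : zmodType) (mul : V -> V -> V) (Da Db Dc : V -> V) x y z :
  (forall r s t, mul (r + s) t = mul r t + mul s t) ->
  (forall r s t, mul r (s + t) = mul r s + mul r t) ->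
  {morph Da : s t / s + t} -> {morph Dc : s t / s + t} ->
  (forall s t, mul (Da s) (Db t) = Da (mul s (Db t)) + Db (mul (Da s) t)) ->
  (forall s t, mul (Da s) (Dc t) = Da (mul s (Dc t)) + Dc (mul (Da s) t)) ->
  (forall s t, mul (Db s) (Dc t) = Db (mul s (Dc t)) + Dc (mul (Db s) t)) ->
  mul x (mul (Db y) (Dc z)) = mul (mul x (Db y)) (Dc z) ->
  mul (Da x) (mul y (Dc z)) = mul (mul (Da x) y) (Dc z) ->
  mul (Da x) (mul (Db y) z) = mul (mul (Da x) (Db y)) z ->
  mul (Da x) (mul (Db y) (Dc z)) = mul (mul (Da x) (Db y)) (Dc z).
Proof.
move=> mDl mDr DaD DcD ab ac bc E3 E2 E1.
transitivity (Da (mul x (mul (Db y) (Dc z))) + Db (mul (Da x) (mul y (Dc z))) +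
              Dc (mul (Da x) (mul (Db y) z))).
  by rewrite bc !mDr ab ac DaD !addrA; congr (_ + _); rewrite addrAC.
rewrite E1 E2 E3 ab !mDl ac bc DcD -!addrA; congr (_ + _).
by rewrite addrCA.
Qed.

Section BlockShuffleAlgebra.
Variables (K : comNzRingType) (d : nat).
Local Notation H := {malg K[mcomp d]}.
Local Notation mul := (@block_shuffle K d).
Implicit Types (a b c : con_comp d) (u v w : seq (con_comp d)) (x y z : H).

Local Notation bsw := (@block_shuffle_words K d).
Local Notation word_basis u := (basis K (diags u)).

Lemma block_shuffleEext : mul = bilinear_ext (fun x y : mcomp d => bsw (blocks x) (blocks y)).
Proof. by []. Qed.

Lemma block_shuffle_words_cons a u b v : bsw (a :: u) (b :: v) =
  diag_H (val a) (bsw u (b :: v)) + diag_H (val b) (bsw (a :: u) v).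
Proof. by []. Qed.

Lemma block_shuffle_wordsC u v : bsw u v = bsw v u.
Proof.
elim: u v => [|a u IHu] v; first by case: v.
elim: v => [|b v IHv]; first by [].
apply: etrans (block_shuffle_words_cons a u b v) _.
apply: etrans _ (esym (block_shuffle_words_cons b v a u)).
apply: etrans (addrC _ _) _.
exact: (congr2 +%R (congr1 (diag_H (val b)) IHv) (congr1 (diag_H (val a)) (IHu (b :: v)))).
Qed.

Lemma diag_H_linear (a : mcomp d) : linear (@diag_H K d a).
Proof. exact: linear_extension_linear. Qed.

Lemma diag_H_basis (a c : mcomp d) : diag_H a (basis K c) = basis K (diag a c).
Proof. exact: linear_extU. Qed.

Lemma block_shuffleC : commutative mul.
Proof.
by rewrite block_shuffleEext; apply: bilinear_commutative => a b; apply: block_shuffle_wordsC.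
Qed.

Lemma block_shuffle1 : left_id (unit_H K d) mul.
Proof.
rewrite block_shuffleEext; apply: bilinear_left_unit => b.
by rewrite blocks_empty -{2}(blocksK b); case: (blocks b).
Qed.

Lemma block_shuffle_rec a b x y :
  mul (diag_H (val a) x) (diag_H (val b) y) =
  diag_H (val a) (mul x (diag_H (val b) y)) + diag_H (val b) (mul (diag_H (val a) x) y).
Proof.
have la := @diag_H_linear (val a); have lb := @diag_H_linear (val b).
have ml z : linear (mul^~ z) by exact: bilinear_linearl.
have mr z : linear (mul z) by exact: bilinear_linearr.
have lin_add (F G : H -> H) : linear F -> linear G -> linear (fun x => F x + G x).
  by move=> lF lG k s t; rewrite lF lG scalerDr addrACA.
move: x; apply: (linear_basis_eq
  (F := fun x => mul (diag_H (val a) x) (diag_H (val b) y))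
  (G := fun x => diag_H (val a) (mul x (diag_H (val b) y)) +
                 diag_H (val b) (mul (diag_H (val a) x) y))).
- exact: (linear_comp (F := mul^~ _) (ml _) la).
- apply: lin_add; first exact: linear_comp la (ml _).
  exact: linear_comp lb (linear_comp (F := mul^~ _) (ml _) la).
move=> c; move: y; apply: (linear_basis_eq
  (F := fun y => mul (diag_H (val a) (basis K c)) (diag_H (val b) y))
  (G := fun y => diag_H (val a) (mul (basis K c) (diag_H (val b) y)) +
                 diag_H (val b) (mul (diag_H (val a) (basis K c)) y))).
- exact: linear_comp (mr _) lb.
- apply: lin_add; first exact: linear_comp la (linear_comp (mr _) lb).
  exact: linear_comp lb (mr _).
move=> e; rewrite !diag_H_basis.
exact: block_shuffleE (valP a) (valP b).
Qed.

Lemma block_shuffle_wordsA u v w :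
  mul (word_basis u) (mul (word_basis v) (word_basis w)) =
  mul (mul (word_basis u) (word_basis v)) (word_basis w).
Proof.
have m1r x : mul x (unit_H K d) = x by rewrite block_shuffleC block_shuffle1.
have mDl x y z : mul (x + y) z = mul x z + mul y z.
  exact: linear_mapD (@bilinear_linearl K d _ z).
have mDr x y z : mul x (y + z) = mul x y + mul x z.
  exact: linear_mapD (@bilinear_linearr K d _ x).
have dD a x y : diag_H (val a) (x + y) = diag_H (val a) x + diag_H (val a) y.
  exact: linear_mapD (@diag_H_linear (val a)).
elim: u v w => [|a u IHu] v w; first by rewrite !block_shuffle1.
elim: v w => [|b v IHv] w; first by rewrite block_shuffle1 m1r.
elim: w => [|c w IHw]; first by rewrite !m1r.
have wE (e : con_comp d) t : word_basis (e :: t) = diag_H (val e) (word_basis t).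
  exact/esym/diag_H_basis.
have := IHu (b :: v) (c :: w); have := IHv (c :: w); move: IHw.
rewrite !wE; move: (word_basis u) (word_basis v) (word_basis w) => x y z E1 E2 E3.
apply: shuffle_associative_step E3 E2 E1; try exact: block_shuffle_rec.
- exact: mDl.
- exact: mDr.
- by move=> s t; apply: dD.
by move=> s t; apply: dD.
Qed.

Lemma block_shuffleA : associative mul.
Proof.
rewrite block_shuffleEext; apply: bilinear_associative => a b c.
by rewrite -block_shuffleEext -(blocksK a) -(blocksK b) -(blocksK c) block_shuffle_wordsA.
Qed.

Lemma diag_H_basis_sum (P P' : mcomp d -> Prop) (a e : mcomp d) (x : H) :
  (forall c : mcomp d, P c -> P' (diag a c)) ->
  basis_sum_with P e x -> basis_sum_with P' (diag a e) (diag_H a x).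
Proof.
move=> PP' [s [-> es sP]]; exists [seq diag a c | c : mcomp d <- s]; split.
- rewrite (linear_big _ _ (@diag_H_linear a)) big_map; apply: eq_bigr => c _.
  exact: diag_H_basis.
- exact: map_f.
by move=> _ /mapP[c /sP Pc ->]; apply: PP'.
Qed.

Lemma block_shuffle_words_sum u v :
  basis_sum_with (fun c : mcomp d => shuf u v (blocks c)) (diags (u ++ v)) (bsw u v).
Proof.
elim: u v => [|a u IHu] v.
  rewrite (_ : bsw [::] v = word_basis v); last by case: v.
  by apply: basis_sum_with_basis; rewrite diagsK; apply: shuf0w.
elim: v => [|b v IHv].
  rewrite cats0; apply: (@basis_sum_with_basis _ _ _ (diags (a :: u))).
  by rewrite diagsK; apply: shuf_sym; apply: shuf0w.
rewrite block_shuffle_words_cons.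
have blocks_cons (e : con_comp d) (c : mcomp d) : blocks (diag (val e) c) = e :: blocks c.
  by rewrite -[RHS]diagsK /= blocksK.
apply: basis_sum_withD.
  apply: diag_H_basis_sum (IHu (b :: v)) => c H; rewrite blocks_cons.
  by constructor.
apply: basis_sum_with_of; apply: diag_H_basis_sum IHv => c H; rewrite blocks_cons.
by constructor.
Qed.

Lemma block_shuffle_basis_sum (c e : mcomp d) :
  basis_sum_with (shuffle_bound c e) (diag c e) (bsw (blocks c) (blocks e)).
Proof.
have [s [-> ds sP]] := block_shuffle_words_sum (blocks c) (blocks e).
exists s; split=> //; last by move=> t /sP; right.
by move: ds; rewrite -blocks_diag blocksK.
Qed.
End BlockShuffleAlgebra.

(** * Free generation by Lyndon words *)

Theorem theorem3p12 (K : comAlgType rat) (d : nat) (d_gt0 : (0 < d)%N)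
    (lt : rel (con_comp d))
    (lt_irr : irreflexive lt) (lt_trans : transitive lt)
    (lt_total : forall a b : con_comp d, a != b -> lt a b || lt b a) :
  [/\ freely_generates (@block_shuffle K d) (unit_H K d) (@lyndon_basis K d lt),
      freely_generates (@shuffle K d) (unit_H K d) (@lyndon_basis K d lt)
    & freely_generates (@quasi_shuffle K d) (unit_H K d) (@lyndon_basis K d lt)].
Proof.
split.
- apply: (lyndon_freely_generates lt_irr lt_trans lt_total (mul := @block_shuffle K d)
    (@bilinear_linearl K d _) (@bilinear_linearr K d _)
    (@block_shuffleC K d) (@block_shuffleA K d) (@block_shuffle1 K d)) => a b.
  by rewrite block_shuffleEext bilinear_extU; apply: block_shuffle_basis_sum.
- apply: (lyndon_freely_generates lt_irr lt_trans lt_total (mul := @shuffle K d)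
    (@bilinear_linearl K d _) (@bilinear_linearr K d _)
    (@shuffleC K d) (@shuffleA K d) (@shuffle1 K d)) => a b.
  by rewrite -shuffle_basisE; apply: shuffle_basis_sum.
- apply: (lyndon_freely_generates lt_irr lt_trans lt_total (mul := @quasi_shuffle K d)
    (@bilinear_linearl K d _) (@bilinear_linearr K d _)
    (@quasi_shuffleC K d) (@quasi_shuffleA K d) (@quasi_shuffle1 K d)) => a b.
  by rewrite -quasi_shuffle_basisE; apply: quasi_shuffle_basis_sum.
Qed.
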